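(* Let $C>0$ and let $a_1,a_2,a_3$ be three real constants, not all of them equal to each other. Consider the product of the seven-dimensional quaternionic Heisenberg group (with global coordinates $x_1,\dots,x_7$) with the real line (with coordinate $u$, in the range $u+a_1>0$, $u+a_2>0$, $u+a_3>0$). The metric $$\begin{aligned} g=\;&C\big((u+a_1)(u+a_2)(u+a_3)\big)^{1/9}(dx_1^2+dx_2^2+dx_3^2+dx_4^2)\\ &+\frac6C\left(\frac{(u+a_2)^8(u+a_3)^8}{(u+a_1)^{10}}\right)^{1/9}(dx_5+2x_1dx_2+2x_3dx_4)^2 +\frac6C\left(\frac{(u+a_3)^8(u+a_1)^8}{(u+a_2)^{10}}\right)^{1/9}(dx_6+2x_1dx_3+2x_4dx_2)^2\\ &+\frac6C\left(\frac{(u+a_1)^8(u+a_2)^8}{(u+a_3)^{10}}\right)^{1/9}(dx_7+2x_1dx_4+2x_2dx_3)^2 +\left(\frac C6\right)^3\frac{du^2}{\big((u+a_1)(u+a_2)(u+a_3)\big)^{2/3}} \end{aligned}$$ supports an almost quaternion hermitian structure which has closed fundamental 4-form, but is not quaternionic K\''ahler.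
   Context: An almost quaternion hermitian structure on an 8-manifold is a Riemannian metric $g$ together with a rank-three bundle of endomorphisms locally generated by almost complex structures $J_1,J_2,J_3$ satisfying the quaternion identities and with $g(J_s\cdot,J_s\cdot)=g$. With local K\''ahler forms $F_s=g(J_s\cdot,\cdot)$, its fundamental 4-form is the globally defined form $\Phi=F_1\wedge F_1+F_2\wedge F_2+F_3\wedge F_3$. The structure is quaternionic K\''ahler if the holonomy of the Levi-Civita connection of $g$ is contained in $Sp(2)Sp(1)$, equivalently if $\Phi$ is parallel with respect to the Levi-Civita connection. The seven-dimensional quaternionic Heisenberg group is the simply connected Lie group with a left invariant coframe $e^1,\dots,e^4,\eta_1,\eta_2,\eta_3$ satisfying $de^a=0$, $d\eta_1=2(e^{12}+e^{34})$, $d\eta_2=2(e^{13}+e^{42})$, $d\eta_3=2(e^{14}+e^{23})$ (where $e^{ij}=e^i\wedge e^j$); in the coordinates used, $e^a=dx_a$ for $a=1,\dots,4$, $\eta_1=dx_5+2x_1dx_2+2x_3dx_4$, $\eta_2=dx_6+2x_1dx_3+2x_4dx_2$, $\eta_3=dx_7+2x_1dx_4+2x_2dx_3$. *)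

(* Defs.v *)
From HB Require Import structures.
From mathcomp Require Import all_boot all_order all_fingroup all_algebra.
From mathcomp Require Import all_classical all_reals all_analysis.

Set Implicit Arguments.
Unset Strict Implicit.
Unset Printing Implicit Defensive.

Import Order.TTheory GRing.Theory Num.Theory numFieldNormedType.Exports.

Local Open Scope classical_set_scope.
Local Open Scope ring_scope.

(* Geometry on an open set U of R^(n+1), in the global chart given by the
   inclusion: points and tangent vectors are column vectors, an endomorphism J
   of a tangent space acts by X |-> J *m X (so composition is *m), a metric is
   its Gram matrix, and a k-form at a point is a function of k vectors. *)
Section ChartGeometry.
Variables (R : realType) (n : nat).
Local Notation E := 'cV[R]_n.+1.
Local Notation M := 'M[R]_n.+1.

Definition diff_form (k : nat) : Type := E -> ('I_k -> E) -> R.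

(* C^infinity: every iterated directional derivative (along constant vectors)
   is Frechet differentiable, hence continuous, at every point of U. *)
Definition smooth (U : set E) (f : E -> R) : Prop :=
  forall (s : seq E) (p : E), U p ->
    differentiable (foldr (fun v (h : E -> R) => fun q => 'D_v h q) f s) p.

Definition smooth_mx (U : set E) (A : E -> M) : Prop :=
  forall i j, smooth U (fun p => A p i j).

Definition inner (G : M) (X Y : E) : R := (X^T *m G *m Y) 0 0.

Definition riemannian_metric (U : set E) (g : E -> M) : Prop :=
  smooth_mx U g /\
  forall p, U p -> (g p)^T = g p /\ forall X : E, X != 0 -> 0 < inner (g p) X X.

(* (J1, J2, J3) is a local frame, on V, of the bundle Q of endomorphisms of the
   tangent spaces: almost complex structures which satisfy the quaternion
   identities, are g-hermitian, and span the fibres of Q. *)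
Definition quaternionic_frame (V : set E) (g : E -> M) (Q : E -> {vspace M})
    (J1 J2 J3 : E -> M) : Prop :=
  [/\ smooth_mx V J1, smooth_mx V J2, smooth_mx V J3 &
    forall p, V p ->
      [/\ [/\ J1 p *m J1 p = - 1%:M, J2 p *m J2 p = - 1%:M
            & J3 p *m J3 p = - 1%:M],
          J1 p *m J2 p = J3 p /\ J2 p *m J1 p = - J3 p,
          forall X Y : E,
            [/\ inner (g p) (J1 p *m X) (J1 p *m Y) = inner (g p) X Y,
                inner (g p) (J2 p *m X) (J2 p *m Y) = inner (g p) X Y
              & inner (g p) (J3 p *m X) (J3 p *m Y) = inner (g p) X Y]
        & Q p = <<[:: J1 p; J2 p; J3 p]>>%VS]].

(* Such J1, J2, J3 are linearly independent, so Q has rank three. *)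
Definition almost_quaternion_hermitian (U : set E) (g : E -> M)
    (Q : E -> {vspace M}) : Prop :=
  riemannian_metric U g /\
  forall p, U p -> exists V : set E,
    [/\ open V, V p, V `<=` U
      & exists J1 J2 J3 : E -> M, quaternionic_frame V g Q J1 J2 J3].

Definition kahler_form (g J : E -> M) : diff_form 2 :=
  fun p v => inner (g p) (J p *m v 0) (v 1).

(* Normalised so that (alpha /\ beta)(X, Y) = alpha X * beta Y - alpha Y * beta X
   for 1-forms. *)
Definition wedge (k l : nat) (a : diff_form k) (b : diff_form l) : diff_form (k + l) :=
  fun p v => (k`! * l`!)%:R^-1 *
    \sum_(s : 'S_(k + l)) (-1) ^+ s *
      (a p (fun i => v (s (lshift l i))) * b p (fun j => v (s (rshift k j)))).

Definition is_fundamental_form (U : set E) (g : E -> M) (Q : E -> {vspace M})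
    (Phi : diff_form 4) : Prop :=
  forall (V : set E) (J1 J2 J3 : E -> M),
    open V -> V `<=` U -> quaternionic_frame V g Q J1 J2 J3 ->
    forall p v, V p ->
      Phi p v = wedge (kahler_form g J1) (kahler_form g J1) p v
              + wedge (kahler_form g J2) (kahler_form g J2) p v
              + wedge (kahler_form g J3) (kahler_form g J3) p v.

(* The vectors v i are extended to constant, hence commuting, vector fields, so
   no bracket terms occur. *)
Definition ext_d (k : nat) (a : diff_form k) : diff_form k.+1 :=
  fun p v => \sum_(i < k.+1)
    (-1) ^+ i * 'D_(v i) (fun q => a q (fun j => v (lift i j))) p.

Definition closed_form (U : set E) (k : nat) (a : diff_form k) : Prop :=
  forall p v, U p -> ext_d a p v = 0.

Definition partial (i : 'I_n.+1) (f : E -> R) (p : E) : R :=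
  'D_(delta_mx i 0) f p.

(* Gamma^l_(ij) of the Levi-Civita connection of g. *)
Definition christoffel (g : E -> M) (l i j : 'I_n.+1) (p : E) : R :=
  2^-1 * \sum_m invmx (g p) l m *
    (partial i (fun q => g q j m) p + partial j (fun q => g q i m) p
     - partial m (fun q => g q i j) p).

(* nabla_X Y at p, for the constant vector fields X and Y. *)
Definition levi_civita (g : E -> M) (p X Y : E) : E :=
  \col_l \sum_i \sum_j christoffel g l i j p * X i 0 * Y j 0.

(* (nabla_X a)(v_0, ..., v_(k-1)) at p. *)
Definition cov_deriv (g : E -> M) (k : nat) (a : diff_form k) (p X : E)
    (v : 'I_k -> E) : R :=
  'D_X (fun q => a q v) p
  - \sum_(i < k)
      a p (fun j => if j == i then levi_civita g p X (v i) else v j).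

Definition parallel_form (U : set E) (g : E -> M) (k : nat) (a : diff_form k) : Prop :=
  forall p X v, U p -> cov_deriv g a p X v = 0.

Definition quaternionic_kahler (U : set E) (g : E -> M) (Q : E -> {vspace M}) :
    Prop :=
  forall Phi : diff_form 4, is_fundamental_form U g Q Phi -> parallel_form U g Phi.

End ChartGeometry.

(* Coordinates x_1, ..., x_7, x_8 = u on R^8: the index k runs from 1 to 8. *)
Section HeisenbergTimesLine.
Variable R : realType.
Local Notation E := 'cV[R]_8.

Definition coord (k : nat) (p : E) : R := p (inord k.-1) 0.

Definition dx (k : nat) : 'rV[R]_8 := delta_mx 0 (inord k.-1).

(* Left invariant forms of the quaternionic Heisenberg group. *)
Definition eta1 (p : E) : 'rV[R]_8 :=
  dx 5 + (2 * coord 1 p) *: dx 2 + (2 * coord 3 p) *: dx 4.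
Definition eta2 (p : E) : 'rV[R]_8 :=
  dx 6 + (2 * coord 1 p) *: dx 3 + (2 * coord 4 p) *: dx 2.
Definition eta3 (p : E) : 'rV[R]_8 :=
  dx 7 + (2 * coord 1 p) *: dx 4 + (2 * coord 2 p) *: dx 3.

(* Gram matrix of the symmetric square of a 1-form. *)
Definition sym_sq (t : 'rV[R]_8) : 'M[R]_8 := t^T *m t.

Definition heis_domain (a1 a2 a3 : R) : set E :=
  [set p | [/\ 0 < coord 8 p + a1, 0 < coord 8 p + a2 & 0 < coord 8 p + a3]].

Definition heis_metric (C a1 a2 a3 : R) (p : E) : 'M[R]_8 :=
  let v1 := coord 8 p + a1 in
  let v2 := coord 8 p + a2 in
  let v3 := coord 8 p + a3 in
  (C * (v1 * v2 * v3) `^ (1 / 9)) *: (sym_sq (dx 1) + sym_sq (dx 2) + sym_sq (dx 3) + sym_sq (dx 4))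
  + (6 / C * (v2 ^+ 8 * v3 ^+ 8 / v1 ^+ 10) `^ (1 / 9)) *: sym_sq (eta1 p)
  + (6 / C * (v3 ^+ 8 * v1 ^+ 8 / v2 ^+ 10) `^ (1 / 9)) *: sym_sq (eta2 p)
  + (6 / C * (v1 ^+ 8 * v2 ^+ 8 / v3 ^+ 10) `^ (1 / 9)) *: sym_sq (eta3 p)
  + ((C / 6) ^+ 3 / (v1 * v2 * v3) `^ (2 / 3)) *: sym_sq (dx 8).

End HeisenbergTimesLine.

(* Main.v *)
From HB Require Import structures.
From mathcomp Require Import all_boot all_order all_fingroup all_algebra.
From mathcomp Require Import all_classical all_reals all_analysis.
From mathcomp Require Import ring lra.
Require Import Defs.

Import Order.TTheory GRing.Theory Num.Theory numFieldNormedType.Exports.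
Local Open Scope classical_set_scope.
Local Open Scope ring_scope.
Set Implicit Arguments.
Unset Strict Implicit.
Unset Printing Implicit Defensive.

(** Write v_s = u + a_s and v = v_1 v_2 v_3. The metric is the sum of the squares
    of the coframe A dx_1, ..., A dx_4, B_1 eta_1, B_2 eta_2, B_3 eta_3, D du with
      A^2 = C v^(1/9),  B_s = kappa v^(4/9) / v_s,  D = kappa^(-3) v^(-1/3),
    where kappa^2 = 6 / C.
    Let J_1, J_2, J_3 act on this coframe by constant signed permutations, namely
    as multiplication by the quaternion units on each of the two blocks
    (dx_1, ..., dx_4) and (du, eta_1, eta_2, eta_3). With d eta_s = 2 omega_s and
    (s, t, r) cyclic, the Kaehler forms are (kahler_formE)
      F_s = A^2 omega_s + D B_s du /\ eta_s + B_t B_r eta_t /\ eta_r,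
    so that, with alpha = A^4 = C^2 v^(2/9), the fundamental form is the sum over s of
      alpha omega_s^2 + alpha / (3 v_s) omega_s /\ du /\ eta_s
        + 12 v_s omega_s /\ eta_t /\ eta_r + 2 du /\ eta_s /\ eta_t /\ eta_r
    (the four coefficients are computed in the lemma coefficients). Any other
    quaternionic frame of the same bundle is a pointwise rotation of this one, and
    a sum of squares is invariant under rotations (span_rotation,
    sum_products_rotation), whence heis_Phi_fundamental.

    Closedness (alt5_phi'). The forms omega_s^2 are all equal and
    omega_s /\ omega_t = 0 for s <> t. The differential therefore only has
    components along du /\ omega_s^2 and du /\ omega_s /\ eta_t /\ eta_r. The
    former vanish because alpha' = (2/9) alpha (1/v_1 + 1/v_2 + 1/v_3), the latter
    because v_s' = 1: the differential of du /\ eta_1 /\ eta_2 /\ eta_3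
    compensates that of v_s omega_s /\ eta_t /\ eta_r.

    Failure of parallelism (parallel_height_eq). Up to the Lie algebra of
    Sp(2)Sp(1), the operator nabla along d/dx_1 maps one quaternionic line of the
    coframe to the other by a diagonal matrix with entries k D and B_1, B_2, B_3 up
    to a common factor; it preserves the fundamental form only if this matrix is
    scalar. Concretely, at a point with x = 0 the components of nabla Phi on
    (d/dx_1, d/dx_(t+1), d/dx_(r+1), d/dx_(s+4)) give
      4 B_s = B_1 + B_2 + B_3 + k D   for s = 1, 2, 3,
    with the same k in the three equations. If Phi is parallel then
    B_1 = B_2 = B_3, hence v_1 = v_2 = v_3, against the hypothesis on a_1, a_2,
    a_3. *)

(** * Smoothness *)

(** The differential is a chosen linear map, so it has to be shown that the two
    germs select the same one; diff_unique does this. *)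
Lemma near_eq_differentiable (R : numFieldType) (V W : normedModType R) (f g : V -> W) p :
  (\near p, f p = g p) -> differentiable f p -> differentiable g p.
Proof.
move=> fg /diff_locallyP [cdf fE].
have gE : g \o shift p = cst (g p) + 'd f p +o_ 0 id.
  apply/eqaddoP => e e0.
  move/eqaddoP: fE => /(_ e e0).
  have : \forall h \near 0, f (h + p) = g (h + p).
    by move: fg; rewrite (near_shift 0) subr0.
  apply: filterS2 => h fgh.
  by rewrite /= !fctE /= (nbhs_singleton fg) fgh.
have dE : 'd g p = 'd f p :> (V -> W) by apply: diff_unique.
by apply/diff_locallyP; rewrite dE; split.
Qed.

Section SmoothClass.
Variables (R : realType) (n : nat) (U : set 'cV[R]_n.+1).
Hypothesis oU : open U.
Variable S : ('cV[R]_n.+1 -> R) -> Prop.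
Hypothesis S_diff : forall f p, S f -> U p -> differentiable f p.
Hypothesis S_deriv : forall f w, S f ->
  exists2 g, S g & forall p, U p -> 'D_w f p = g p.

Lemma eq_near_open (f g : 'cV[R]_n.+1 -> R) p :
  (forall q, U q -> f q = g q) -> U p -> \near p, f p = g p.
Proof. by move=> fg Up; apply: filterS fg _; exact: open_nbhs_nbhs. Qed.

(** Iterated derivatives never leave the class, up to equality on the open set U,
    so smoothness reduces to first-order differentiability of the class. *)
Lemma smooth_of_class f g : S g -> (forall p, U p -> f p = g p) -> smooth U f.
Proof.
move=> Sg fg s.
suff [h Sh fh] : exists2 h, S h & forall p, U p ->
    foldr (fun v (h : 'cV[R]_n.+1 -> R) => fun q => 'D_v h q) f s p = h p.
  move=> p Up; apply: (near_eq_differentiable _ (S_diff Sh Up)).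
  by apply: eq_near_open Up => q Uq; rewrite fh.
elim: s => [|w s [h Sh fh]] /=; first by exists g.
have [k Sk hk] := S_deriv w Sh; exists k => // p Up.
by rewrite -hk //; apply: near_eq_derive; exact: eq_near_open.
Qed.
End SmoothClass.

(** * Directional derivatives *)

Section DerivativeRules.
Variables (R : realType) (V : normedModType R) (p w : V).
Implicit Types f g : V -> R.

(* The rules are stated for functions under a binder, the form in which the
   coefficients of forms and metrics appear. *)

Lemma is_derive_fun_cst (c : R) : is_derive p w (fun=> c) 0.
Proof. exact: is_derive_cst. Qed.

Lemma is_derive_fun_add f g df dg : is_derive p w f df -> is_derive p w g dg ->
  is_derive p w (fun q => f q + g q) (df + dg).
Proof. by move=> hf hg; exact: is_deriveD. Qed.

Lemma is_derive_fun_sub f g df dg : is_derive p w f df -> is_derive p w g dg ->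
  is_derive p w (fun q => f q - g q) (df - dg).
Proof. by move=> hf hg; exact: is_deriveB. Qed.

Lemma is_derive_fun_mul f g df dg : is_derive p w f df -> is_derive p w g dg ->
  is_derive p w (fun q => f q * g q) (df * g p + f p * dg).
Proof.
move=> hf hg; apply: (is_derive_eq (is_deriveM hf hg)).
by rewrite /GRing.scale /= addrC mulrC.
Qed.

Lemma is_derive_fun_inv f df : f p != 0 -> is_derive p w f df ->
  is_derive p w (fun q => (f q)^-1) (- df / f p ^+ 2).
Proof.
move=> fp [hf <-]; apply: DeriveDef; first exact: derivableV.
by rewrite deriveV // /GRing.scale /= mulNr -mulNr mulrC mulNr mulrN.
Qed.
End DerivativeRules.

Section Coordinates.
Variable R : realType.
Local Notation E := 'cV[R]_8.

Fact coord_linear k : linear (coord k : E -> R).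
Proof. by move=> a x y; rewrite /coord !mxE. Qed.
HB.instance Definition _ k :=
  GRing.isLinear.Build R E R _ (coord k) (@coord_linear k).

Lemma is_derive_coord k (p w : E) : is_derive p w (coord k) (coord k w).
Proof.
have dc : differentiable (coord k : E -> R) p by exact: differentiable_coord.
apply: DeriveDef; first exact: diff_derivable.
rewrite deriveE // diff_lin //.
exact: coord_continuous.
Qed.

Lemma differentiable_powR_coord k a r (p : E) : 0 < coord k p + a ->
  differentiable (fun q : E => (coord k q + a) `^ r) p.
Proof.
move=> kp.
apply: (@differentiable_comp R _ _ _ (fun q : E => coord k q + a) (fun x : R => x `^ r)).
  apply: (@differentiableD R _ _ (coord k) (cst a)); first exact: differentiable_coord.
  exact: differentiable_cst.
by have [dr _] := is_derive1_powR r kp; apply/derivable1_diffP.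
Qed.

Lemma is_derive_powR_coord k a r (p w : E) : 0 < coord k p + a ->
  is_derive p w (fun q : E => (coord k q + a) `^ r)
    (r * (coord k p + a) `^ (r - 1) * coord k w).
Proof.
move=> kp.
have dc : differentiable (fun q : E => coord k q + a) p.
  apply: (@differentiableD R _ _ (coord k) (cst a)); first exact: differentiable_coord.
  exact: differentiable_cst.
have [dr er] := is_derive1_powR r kp.
have dr' : differentiable (fun x : R => x `^ r) (coord k p + a) by apply/derivable1_diffP.
apply: DeriveDef; first exact/diff_derivable/differentiable_powR_coord.
rewrite deriveE; last exact: differentiable_powR_coord.
rewrite (@diff_comp R _ _ _ (fun q : E => coord k q + a) (fun x : R => x `^ r)) //=.
rewrite deriv1E //= derive1E er -deriveE //.
have [_ ->] := @is_deriveD _ _ _ (coord k) (cst a) p w _ _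
  (is_derive_coord k p w) (is_derive_cst a p w).
by rewrite addr0 /GRing.scale /= mulrC.
Qed.
End Coordinates.

(** * Small index types *)

Lemma ord3_ind (P : 'I_3 -> Prop) : P 0 -> P 1 -> P 2%R -> forall s, P s.
Proof.
move=> P0 P1 P2; case=> [[|[|[|]]]] //= lt;
  [have -> : Ordinal lt = 0|have -> : Ordinal lt = 1|have -> : Ordinal lt = 2%R] => //;
  exact: val_inj.
Qed.

(** The indices 1, 2, 3 of the quaternion units are elements of Z/3, so that
    (s, s + 1, s + 2) is always a cyclic permutation of them. *)
Lemma ord3D : (0 + 1 = 1 :> 'I_3) * (0 + 2 = 2%R :> 'I_3) * (1 + 1 = 2%R :> 'I_3)
  * (1 + 2 = 0 :> 'I_3) * (2 + 1 = 0 :> 'I_3) * (2 + 2 = 1 :> 'I_3).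
Proof. by do !split; apply: val_inj. Qed.

Lemma ord3_val : ((0 : 'I_3) = 0%N :> nat) * ((1 : 'I_3) = 1%N :> nat) *
  ((2%R : 'I_3) = 2%N :> nat).
Proof. by []. Qed.

Lemma big_ord8 (V : nmodType) (F : 'I_8 -> V) : \sum_i F i =
  F (inord 0) + F (inord 1) + F (inord 2) + F (inord 3)
  + F (inord 4) + F (inord 5) + F (inord 6) + F (inord 7).
Proof.
rewrite !big_ord_recl big_ord0 addr0 !addrA.
by do ![congr (_ + _)]; congr F; apply: val_inj; rewrite /= inordK.
Qed.

Lemma big_ord3 (V : nmodType) (F : 'I_3 -> V) : \sum_s F s = F 0 + F 1 + F 2%R.
Proof.
rewrite !big_ord_recl big_ord0 addr0 addrA; congr (_ + F _ + F _); exact: val_inj.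
Qed.

(** * Forms of low degree *)

Definition wedge11 (R : pzRingType) (T : Type) (f g : T -> R) (x y : T) : R :=
  f x * g y - f y * g x.

(** The sum over the six (2,2)-shuffles: the wedge product of two 2-forms once
    repeated terms are collected. *)
Definition wedge22 (R : pzRingType) (T : Type) (F G : T -> T -> R) (x y z w : T) : R :=
  F x y * G z w + F z w * G x y - F x z * G y w - F y w * G x z
  + F x w * G y z + F y z * G x w.

Section WedgeOfTwoForms.
Variable R : realType.

(** A permutation is determined by its value at 0 and the permutation which it
    induces on the remaining points; iterating this enumerates S_4. *)
Lemma sum_lift_perm n (F : 'S_n.+1 -> R) :
  \sum_s F s = \sum_i \sum_t F (lift_perm ord0 i t).
Proof.
pose h (q : 'I_n.+1 * 'S_n) := lift_perm ord0 q.1 q.2.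
have h_inj : injective h.
  move=> [i s] [j t] /= hE.
  have ij : i = j by move/permP/(_ ord0): hE; rewrite !lift_perm_id.
  subst j; congr (_, _); apply/permP => k; apply: (@lift_inj _ i).
  by move/permP/(_ (lift ord0 k)): hE; rewrite !lift_perm_lift.
rewrite pair_big (reindex h) //=; apply/onW_bij/(inj_card_bij h_inj).
by rewrite card_prod !card_Sn card_ord factS.
Qed.

Lemma signed_sum_S4 (F : 'I_4 -> 'I_4 -> 'I_4 -> 'I_4 -> R) :
  \sum_(s : 'S_4) (-1) ^+ s * F (s 0) (s (lift 0 0)) (s (lift 0 (lift 0 0)))
                               (s (lift 0 (lift 0 (lift 0 0)))) =
  \sum_(i < 4) \sum_(j < 3) \sum_(k < 2)
    (-1) ^+ (i + j + k) * F i (lift i j) (lift i (lift j k))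
                                (lift i (lift j (lift k 0))).
Proof.
rewrite sum_lift_perm; apply: eq_bigr => i _.
rewrite sum_lift_perm; apply: eq_bigr => j _.
rewrite sum_lift_perm; apply: eq_bigr => k _.
rewrite sum_lift_perm big_ord1 (big_pred1 1%g) => [|t]; last first.
  by apply/esym/eqP/permP; case.
rewrite !odd_lift_perm !(lift_perm_id, lift_perm_lift) odd_perm1 /=.
by rewrite addbF !signr_addb !signr_odd !exprD mulrA.
Qed.

Variable n : nat.
Local Notation E := 'cV[R]_n.+1.

Lemma wedge_wedge22 (F G : E -> E -> R) (a b : diff_form R n 2) p v :
  (forall x y, F x y = - F y x) -> (forall x y, G x y = - G y x) ->
  (forall u, a p u = F (u 0) (u 1)) -> (forall u, b p u = G (u 0) (u 1)) ->
  wedge a b p v = wedge22 F G (v 0) (v 1) (v 2%R) (v 3%R).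
Proof.
move=> FN GN aE bE; rewrite /wedge /=.
under eq_bigr => s _.
  rewrite aE bE.
  have -> : @lshift 2 2 0 = 0 :> 'I_4 by exact: val_inj.
  have -> : @lshift 2 2 1 = lift 0 0 :> 'I_4 by exact: val_inj.
  have -> : @rshift 2 2 0 = lift 0 (lift 0 0) :> 'I_4 by exact: val_inj.
  have -> : @rshift 2 2 1 = lift 0 (lift 0 (lift 0 0)) :> 'I_4 by exact: val_inj.
  over.
rewrite (signed_sum_S4 (fun i j k l => F (v i) (v j) * G (v k) (v l))).
rewrite !big_ord_recl !big_ord0.
pose e0 : 'I_4 := 0; pose e1 : 'I_4 := 1; pose e2 : 'I_4 := 2%R; pose e3 : 'I_4 := 3%R.
have ordE (i : 'I_4) : i = nth e0 [:: e0; e1; e2; e3] i.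
  by case: i => [[|[|[|[|?]]]]] //= ?; exact: val_inj.
do ![rewrite [lift _ _]ordE /=].
rewrite -[v ord0]/(v e0) -[v 0]/(v e0) -[v 1]/(v e1) -[v 2%R]/(v e2) -[v 3%R]/(v e3).
rewrite (_ : (1 %% 4)%N = 1%N) // /bump /= !addnE /= /wedge22.
rewrite (FN (v e1) (v e0)) (FN (v e2) (v e0)) (FN (v e3) (v e0)) (FN (v e2) (v e1))
  (FN (v e3) (v e1)) (FN (v e3) (v e2)) (GN (v e1) (v e0)) (GN (v e2) (v e0))
  (GN (v e3) (v e0)) (GN (v e2) (v e1)) (GN (v e3) (v e1)) (GN (v e3) (v e2)).
rewrite (_ : (2`! * 2`!)%N = 4%N) //.
by field.
Qed.
End WedgeOfTwoForms.

Section ExteriorAlgebra.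
Variables (R : realType) (E : Type).
Implicit Types (f g h k : E -> R) (F G O : E -> E -> R).

(** The squares of the decomposable summands vanish, so only the three cross
    terms and the square of O remain. *)
Lemma wedge22_sum F O f g h k a b c :
  (forall x y, F x y = a * O x y + b * wedge11 f g x y + c * wedge11 h k x y) ->
  forall x y z t, wedge22 F F x y z t =
    a ^+ 2 * wedge22 O O x y z t + 2 * (a * b) * wedge22 O (wedge11 f g) x y z t
    + 2 * (a * c) * wedge22 O (wedge11 h k) x y z t
    + 2 * (b * c) * wedge22 (wedge11 f g) (wedge11 h k) x y z t.
Proof. by move=> FE x y z t; rewrite /wedge22 !FE /wedge11; ring. Qed.
End ExteriorAlgebra.

Section DerivativeOfWedges.
Variables (R : realType) (V : normedModType R) (p w : V) (T : Type).

Lemma is_derive_wedge11 (f g : V -> T -> R) (df dg : T -> R) x y :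
  (forall x, is_derive p w (f ^~ x) (df x)) -> (forall x, is_derive p w (g ^~ x) (dg x)) ->
  is_derive p w (fun q => wedge11 (f q) (g q) x y)
    (wedge11 df (g p) x y + wedge11 (f p) dg x y).
Proof.
move=> hf hg; rewrite /wedge11.
have := is_derive_fun_sub (is_derive_fun_mul (hf x) (hg y)) (is_derive_fun_mul (hf y) (hg x)).
by move=> h; apply: (is_derive_eq h); ring.
Qed.

Lemma is_derive_wedge22 (F G : V -> T -> T -> R) (dF dG : T -> T -> R) x y z t :
  (forall x y, is_derive p w (fun q => F q x y) (dF x y)) ->
  (forall x y, is_derive p w (fun q => G q x y) (dG x y)) ->
  is_derive p w (fun q => wedge22 (F q) (G q) x y z t)
    (wedge22 dF (G p) x y z t + wedge22 (F p) dG x y z t).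
Proof.
move=> hF hG; rewrite /wedge22.
have hM a b c d := is_derive_fun_mul (hF a b) (hG c d).
have h := is_derive_fun_add (is_derive_fun_add (is_derive_fun_sub (is_derive_fun_sub
  (is_derive_fun_add (hM x y z t) (hM z t x y)) (hM x z y t)) (hM y t x z)) (hM x t y z))
  (hM y z x t).
by apply: (is_derive_eq h); ring.
Qed.
End DerivativeOfWedges.

(** If h is a 1-form whose derivative along w, evaluated at x, is B w x, then
    skew B is dh. The next lemmas are Leibniz rules for products of such forms. *)
Definition skew (R : pzRingType) (T : Type) (B : T -> T -> R) (x y : T) : R :=
  B x y - B y x.

Section AlternatedDerivatives.
Variables (R : realType) (E : Type).
Implicit Types (f g h : E -> R) (B O : E -> E -> R) (G : E -> E -> E -> E -> E -> R).

(** The exterior derivative of a 4-form, in terms of its directional derivatives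
    G w x y z t along w of its value at (x, y, z, t). *)
Definition alt5 G (x y z t u : E) : R :=
  G x y z t u - G y x z t u + G z x y t u - G t x y z u + G u x y z t.

Lemma alt5_wedge_self f g O x y z t u :
  alt5 (fun w x y z t => f w * wedge22 O (wedge11 f g) x y z t) x y z t u = 0.
Proof. by rewrite /alt5 /wedge22 /wedge11; ring. Qed.

(** d(O /\ f /\ h) = - f /\ O /\ O when f is closed and O = dh. *)
Lemma alt5_line f B x y z t u :
  alt5 (fun w => wedge22 (skew B) (wedge11 f (B w))) x y z t u =
  - alt5 (fun w x y z t => f w * wedge22 (skew B) (skew B) x y z t) x y z t u.
Proof. by rewrite /alt5 /wedge22 /wedge11 /skew; ring. Qed.

(** d(O /\ g /\ h) = O /\ dg /\ h - O /\ g /\ dh when O is closed. *)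
Lemma alt5_fibre g h B1 B2 B x y z t u :
  alt5 (fun w x y z t => wedge22 (skew B) (wedge11 (B1 w) h) x y z t
                       + wedge22 (skew B) (wedge11 g (B2 w)) x y z t) x y z t u =
  alt5 (fun w x y z t => h w * wedge22 (skew B) (skew B1) x y z t) x y z t u
  - alt5 (fun w x y z t => g w * wedge22 (skew B) (skew B2) x y z t) x y z t u.
Proof. by rewrite /alt5 /wedge22 /wedge11 /skew; ring. Qed.

(** The Leibniz rule for f /\ g /\ h /\ k with f closed, its three terms brought
    to a cyclically symmetric form. *)
Lemma alt5_vertical f g h k Bg Bh Bk x y z t u :
  alt5 (fun w x y z t => wedge22 (wedge11 f (Bg w)) (wedge11 h k) x y z t
    + wedge22 (wedge11 f g) (wedge11 (Bh w) k) x y z t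
    + wedge22 (wedge11 f g) (wedge11 h (Bk w)) x y z t) x y z t u =
  - alt5 (fun w x y z t => f w * (wedge22 (skew Bg) (wedge11 h k) x y z t
    + wedge22 (skew Bh) (wedge11 k g) x y z t
    + wedge22 (skew Bk) (wedge11 g h) x y z t)) x y z t u.
Proof. by rewrite /alt5 /wedge22 /wedge11 /skew; ring. Qed.
End AlternatedDerivatives.

Section ExteriorDerivative.
Variables (R : realType) (n : nat).
Local Notation E := 'cV[R]_n.+1.

Lemma alt5_ext_d (F : E -> E -> E -> E -> E -> R)
    (F' : E -> E -> E -> E -> E -> E -> R) p (v : 'I_5 -> E) :
  (forall w x y z t, is_derive p w (fun q => F q x y z t) (F' p w x y z t)) ->
  ext_d (k := 4) (fun q (v : 'I_4 -> E) => F q (v 0) (v 1) (v 2%R) (v 3%R)) p v =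
  alt5 (F' p) (v (inord 0)) (v (inord 1)) (v (inord 2)) (v (inord 3)) (v (inord 4)).
Proof.
move=> dF; rewrite /ext_d.
have D w x y z t : 'D_w (fun q => F q x y z t) p = F' p w x y z t by have [_ ->] := dF w x y z t.
pose u k := v (inord k).
have vE (i : 'I_5) : v i = u i by rewrite /u inord_val.
under eq_bigr do rewrite D.
rewrite !big_ord_recl big_ord0 !vE !inordK //.
rewrite /= /bump /= !addnE /= /alt5.
by ring.
Qed.

(** A sum of squares of forms depends only on the sum of their tensor squares. *)
Lemma sum_wedge_squares (a b : 'I_3 -> diff_form R n 2) p v :
  (forall u w, \sum_s a s p u * a s p w = \sum_s b s p u * b s p w) ->
  \sum_s wedge (a s) (a s) p v = \sum_s wedge (b s) (b s) p v.
Proof.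
move=> ab; rewrite /wedge -!mulr_sumr; congr (_ * _).
rewrite exchange_big [RHS]exchange_big; apply: eq_bigr => s _ /=.
by rewrite -!mulr_sumr ab.
Qed.
End ExteriorDerivative.

(** * Quaternionic frames *)

Section QuaternionicFrames.
Variables (R : realType) (n : nat).
Local Notation M := 'M[R]_n.+1.

(** The part of the quaternion identities which is bilinear and symmetric in the
    two units; being a Gram matrix condition, it detects orthogonality of a change
    of frame. *)
Definition clifford (J : 'I_3 -> M) : Prop :=
  forall s t, J s *m J t + J t *m J s = (- ((s == t)%:R *+ 2))%:M.

Lemma clifford_of_quaternions (J : 3.-tuple M) :
  let J1 := tnth J 0 in let J2 := tnth J 1 in let J3 := tnth J 2%R in
  [/\ J1 *m J1 = - 1%:M, J2 *m J2 = - 1%:M & J3 *m J3 = - 1%:M] ->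
  J1 *m J2 = J3 /\ J2 *m J1 = - J3 -> clifford (tnth J).
Proof.
move=> J1 J2 J3 [J1J1 J2J2 J3J3] [J1J2 J2J1].
have a12 : J1 *m J2 + J2 *m J1 = 0 by rewrite J1J2 J2J1 subrr.
have a13 : J1 *m J3 + J3 *m J1 = 0.
  rewrite -{1}J1J2 -[J3 in X in _ + X]opprK -J2J1 mulNmx -!mulmxA J1J1 mulmxN mulmx1.
  by rewrite mulmxA J1J1 mulNmx mul1mx opprK addNr.
have a23 : J2 *m J3 + J3 *m J2 = 0.
  rewrite -{2}J1J2 -[J3]opprK -J2J1 mulmxN mulmxA J2J2 mulNmx mul1mx opprK.
  by rewrite -mulmxA J2J2 mulmxN mulmx1 subrr.
have sq (A : M) : A *m A = - 1%:M -> A *m A + A *m A = (- (1 *+ 2))%:M.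
  by move=> ->; apply/matrixP => i j; rewrite !mxE mulNrn mulr2n mulrnDl opprD.
by move: ord3_ind => ind s t; move: s t; apply: (ind); apply: (ind);
  rewrite /= ?mul0rn ?oppr0 ?raddf0 //; try (by apply: sq); rewrite addrC.
Qed.

(** Expanding the Clifford relations of J' in terms of J shows that the rows of m
    are orthonormal; the columns are then orthonormal too. *)
Lemma clifford_rotation (J J' : 'I_3 -> M) (m : 'M[R]_3) :
  clifford J -> clifford J' -> (forall s, J' s = \sum_t m s t *: J t) ->
  m^T *m m = 1%:M.
Proof.
move=> cJ cJ' J'E; apply: mulmx1C; apply/matrixP => s t; rewrite !mxE.
have := cJ' s t.
have -> : J' s *m J' t + J' t *m J' s =
    \sum_i \sum_j (m s i * m t j) *: (J i *m J j + J j *m J i).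
  rewrite !J'E !mulmx_suml.
  rewrite [X in _ + X = _](eq_bigr (fun i => \sum_j (m t i * m s j) *: (J i *m J j))).
    rewrite exchange_big -big_split; apply: eq_bigr => i _ /=.
    rewrite mulmx_sumr -big_split; apply: eq_bigr => j _ /=.
    by rewrite -scalemxAl -scalemxAr scalerA scalerDr [m t j * _]mulrC.
  move=> i _; rewrite mulmx_sumr; apply: eq_bigr => j _.
  by rewrite -scalemxAl -scalemxAr scalerA.
under eq_bigr => i _.
  under eq_bigr => j _ do rewrite cJ -scalemx1 scalerA.
  rewrite -scaler_suml (bigD1 i) //= eqxx big1 ?addr0; last first.
    by move=> j /negPf ji; rewrite eq_sym ji mul0rn oppr0 mulr0.
  over.
rewrite -scaler_suml => /matrixP/(_ 0 0); rewrite !mxE /= mulr1 mulr1n.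
under eq_bigr do rewrite mulrN.
rewrite sumrN => /oppr_inj; rewrite -mulr_suml => mE.
apply: (@mulIf _ (2%:R : R)); first by rewrite pnatr_eq0.
rewrite /= [RHS]mulr_natr -mE; congr (_ * _).
by apply: eq_bigr => i _; rewrite mxE.
Qed.

(** Invariance of the standard scalar product; with x s and y s the values of the
    three Kaehler forms on two pairs of vectors, it makes the fundamental form
    independent of the frame. *)
Lemma sum_products_rotation (m : 'M[R]_3) (x y x' y' : 'I_3 -> R) :
  m^T *m m = 1%:M -> (forall s, x' s = \sum_t m s t * x t) ->
  (forall s, y' s = \sum_t m s t * y t) ->
  \sum_s x' s * y' s = \sum_s x s * y s.
Proof.
move=> mm x'E y'E.
have -> : \sum_s x' s * y' s = ((\row_s x s) *m (m^T *m m) *m (\col_s y s)) 0 0.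
  rewrite mulmxA -mulmxA mxE; apply: eq_bigr => s _; rewrite !mxE x'E y'E.
  by congr (_ * _); apply: eq_bigr => t _; rewrite !mxE // mulrC.
by rewrite mm mulmx1 mxE; apply: eq_bigr => s _; rewrite !mxE.
Qed.

Lemma span_rotation (J J' : 3.-tuple M) : clifford (tnth J) -> clifford (tnth J') ->
  <<J>>%VS = <<J'>>%VS ->
  exists2 m : 'M[R]_3, m^T *m m = 1%:M &
    forall s, tnth J' s = \sum_t m s t *: tnth J t.
Proof.
move=> cJ cJ' JJ'.
have J'E s : tnth J' s = \sum_t (\matrix_(s, t) vector.coord J t (tnth J' s)) s t *: tnth J t.
  have : tnth J' s \in <<J>>%VS by rewrite JJ'; apply/memv_span/mem_tnth.
  move=> /coord_span {1}->; apply: eq_bigr => t _; rewrite mxE; congr (_ *: _).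
  by rewrite (tnth_nth 0).
exists (\matrix_(s, t) vector.coord J t (tnth J' s)) => //.
exact: clifford_rotation cJ cJ' J'E.
Qed.
End QuaternionicFrames.

Section SignedPermutations.
Variable R : realType.

Definition signed_perm_mx n (s : 'I_n -> 'I_n) (e : 'I_n -> bool) : 'M[R]_n :=
  \matrix_(i, j) ((-1) ^+ e i *+ (j == s i)).

Lemma eq_signed_perm_mx n (s s' : 'I_n -> 'I_n) e e' : s =1 s' -> e =1 e' ->
  signed_perm_mx s e = signed_perm_mx s' e'.
Proof. by move=> ss' ee'; apply/matrixP => i j; rewrite !mxE ss' ee'. Qed.

Lemma signed_perm_mxE n (s : 'I_n -> 'I_n) e (x : 'cV[R]_n) i :
  (signed_perm_mx s e *m x) i 0 = (-1) ^+ e i * x (s i) 0.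
Proof.
rewrite mxE (bigD1 (s i)) //= mxE eqxx big1 ?addr0 // => j /negPf ji.
by rewrite mxE ji mul0r.
Qed.

Lemma mul_signed_perm_mx n (s t : 'I_n -> 'I_n) e f :
  signed_perm_mx s e *m signed_perm_mx t f =
  signed_perm_mx (t \o s) (fun i => e i (+) f (s i)).
Proof.
apply/matrixP => i j; rewrite !mxE (bigD1 (s i)) //= big1 => [|k /negPf ks].
  by rewrite addr0 !mxE eqxx /= mulrnAr -signr_addb.
by rewrite mxE ks mul0r.
Qed.

Lemma signed_perm_mx1 n : signed_perm_mx id xpred0 = 1%:M :> 'M[R]_n.
Proof. by apply/matrixP => i j; rewrite !mxE eq_sym. Qed.

Lemma opp_signed_perm_mx n (s : 'I_n -> 'I_n) e :
  - signed_perm_mx s e = signed_perm_mx s (fun i => ~~ e i).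
Proof.
by apply/matrixP => i j; rewrite !mxE -mulNrn; case: (e i); rewrite /= ?opprK.
Qed.

Lemma tr_signed_perm_mx n (s : 'I_n -> 'I_n) e : involutive s ->
  (signed_perm_mx s e)^T = signed_perm_mx s (e \o s).
Proof.
move=> sK; apply/matrixP => i j; rewrite !mxE /=.
have -> : (i == s j) = (j == s i) by rewrite eq_sym; exact: (can2_eq sK sK).
by case: eqP => // ->.
Qed.
End SignedPermutations.

(* Positions 0 to 3 carry dx_1, ..., dx_4, positions 4 to 6 carry eta_1, eta_2,
   eta_3 and position 7 carries du. The tables are those of the multiplication by
   the quaternion units on the blocks (0, 1, 2, 3) and (7, 4, 5, 6). *)

Definition table_fun (t : seq nat) (i : 'I_8) : 'I_8 := inord (nth 0 t i).
Definition quat_perm (s : 'I_3) : 'I_8 -> 'I_8 :=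
  table_fun (nth [::] [:: [:: 1; 0; 3; 2; 7; 6; 5; 4]; [:: 2; 3; 0; 1; 6; 7; 4; 5];
                 [:: 3; 2; 1; 0; 5; 4; 7; 6]] s)%N.
Definition quat_sign (s : 'I_3) (i : 'I_8) : bool :=
  nth true (nth [::] [:: [:: true; false; true; false; false; true; false; true];
    [:: true; false; false; true; false; false; true; true];
    [:: true; true; false; false; true; false; false; true]] s) i.

Definition quat_unit (R : realType) (s : 'I_3) : 'M[R]_8 :=
  signed_perm_mx R (quat_perm s) (quat_sign s).
Arguments quat_unit : clear implicits.

Local Ltac ord8 := let i := fresh "i" in
  case=> [[|[|[|[|[|[|[|[|i]]]]]]]] //= ?].
Local Ltac case3 := case=> [[|[|[|]]]] //= ?.

Lemma quat_permK s : involutive (quat_perm s).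
Proof.
by move: s; case3; ord8; apply: val_inj; rewrite /quat_perm /table_fun /= !inordK //= !inordK.
Qed.

Lemma quat_signN s i : quat_sign s (quat_perm s i) = ~~ quat_sign s i.
Proof.
by move: s i; case3; ord8; rewrite /quat_sign /quat_perm /table_fun /= !inordK //=.
Qed.

Lemma tr_quat_unit (R : realType) s : (quat_unit R s)^T = - quat_unit R s.
Proof.
rewrite tr_signed_perm_mx; last exact: quat_permK.
by rewrite opp_signed_perm_mx; apply: eq_signed_perm_mx => // i /=; exact: quat_signN.
Qed.

Lemma quat_unit_sq (R : realType) s : quat_unit R s *m quat_unit R s = - 1%:M.
Proof.
rewrite mul_signed_perm_mx -signed_perm_mx1 opp_signed_perm_mx.
by apply: eq_signed_perm_mx => i /=; rewrite ?quat_permK // quat_signN; case: quat_sign.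
Qed.

Lemma quat_unit12 (R : realType) : quat_unit R 0 *m quat_unit R 1 = quat_unit R 2%R.
Proof.
rewrite mul_signed_perm_mx; apply: eq_signed_perm_mx.
  by ord8; apply: val_inj; rewrite /quat_perm /table_fun /= !inordK //= !inordK.
by ord8; rewrite /quat_sign /quat_perm /table_fun /= !inordK.
Qed.

Lemma quat_unit21 (R : realType) : quat_unit R 1 *m quat_unit R 0 = - quat_unit R 2%R.
Proof.
apply: (can_inj trmxK); rewrite trmx_mul linearN /= !tr_quat_unit.
by rewrite mulmxN mulNmx opprK quat_unit12 opprK.
Qed.

(** * The Levi-Civita connection *)

Section LeviCivita.
Variables (R : realType) (n : nat).
Local Notation E := 'cV[R]_n.+1.

Lemma inner_delta (g : 'M[R]_n.+1) (Z : E) m : inner g Z (delta_mx m 0) = (Z^T *m g) 0 m.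
Proof. by rewrite /inner -colE mxE. Qed.

Lemma inner_delta2 (g : 'M[R]_n.+1) i j : inner g (delta_mx i 0) (delta_mx j 0) = g i j.
Proof. by rewrite inner_delta trmx_delta -rowE mxE. Qed.

(** The Koszul formula determines the connection because the metric is
    nondegenerate; for coordinate vector fields it is the definition of the
    Christoffel symbols multiplied by the metric. *)
Lemma levi_civita_koszul (g : E -> 'M[R]_n.+1) p (i j : 'I_n.+1) (Z : E) :
  g p \in unitmx -> (g p)^T = g p ->
  (forall m, inner (g p) Z (delta_mx m 0) = 2^-1 *
     (partial i (fun q => g q j m) p + partial j (fun q => g q i m) p
      - partial m (fun q => g q i j) p)) ->
  levi_civita g p (delta_mx i 0) (delta_mx j 0) = Z.
Proof.
move=> gU gT gZ; apply/colP => l; rewrite mxE.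
rewrite (bigD1 i) //= (bigD1 j) //= !mxE !eqxx !mulr1 /=.
rewrite big1 ?addr0 => [|j' /negPf jj]; last by rewrite !mxE jj mulr0.
rewrite big1 ?addr0 => [|i' /negPf ii]; last first.
  by apply: big1 => j' _; rewrite !mxE ii mulr0 mul0r.
rewrite -[Z in RHS](mulKmx gU) /christoffel mulr_sumr mxE; apply: eq_bigr => m _.
rewrite mulrCA -gZ inner_delta; congr (_ * _).
by rewrite -{1}gT -trmx_mul mxE.
Qed.
End LeviCivita.

(** * Elementary functions of the coordinates *)

Section Heisenberg.
Variables (R : realType) (C a1 a2 a3 : R).
Hypothesis C0 : 0 < C.
Local Notation E := 'cV[R]_8.
Local Notation U := (heis_domain a1 a2 a3).
Local Notation g := (heis_metric C a1 a2 a3).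

(** Arbitrary real exponents make the class stable under derivation and make it
    contain the inverses of all the scale factors of the coframe. *)
Inductive elementary : (E -> R) -> Prop :=
| elementary_cst c : elementary (fun=> c)
| elementary_coord k : elementary (coord k)
| elementary_powR a r : a \in [:: a1; a2; a3] ->
    elementary (fun p => (coord 8 p + a) `^ r)
| elementary_add f g : elementary f -> elementary g -> elementary (fun p => f p + g p)
| elementary_mul f g : elementary f -> elementary g -> elementary (fun p => f p * g p).

Lemma heis_domain_gt0 a p : a \in [:: a1; a2; a3] -> U p -> 0 < coord 8 p + a.
Proof. by rewrite !inE => /or3P[] /eqP -> [] . Qed.

Lemma open_heis_domain : open U.
Proof.
have op a : open [set p : E | 0 < coord 8 p + a].
  apply: (@open_comp _ _ (fun p : E => coord 8 p + a) [set x | 0 < x]).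
    move=> p _; apply: continuousD; [exact: coord_continuous|exact: cst_continuous].
  exact: open_gt.
rewrite (_ : U = [set p : E | 0 < coord 8 p + a1] `&` [set p : E | 0 < coord 8 p + a2]
  `&` [set p : E | 0 < coord 8 p + a3]).
  by do ?apply: openI.
by apply/seteqP; split => p /= [] => [? ? ?|[]].
Qed.

Lemma elementary_diff f p : elementary f -> U p -> differentiable f p.
Proof.
move=> ef Up; elim: ef => [c|k|a r ain|g h _ dg _ dh|g h _ dg _ dh].
- exact: differentiable_cst.
- exact: differentiable_coord.
- exact/differentiable_powR_coord/heis_domain_gt0.
- exact: differentiableD.
- exact: differentiableM.
Qed.

Lemma elementary_derive f w : elementary f ->
  exists2 g, elementary g & forall p, U p -> 'D_w f p = g p.
Proof.
elim=> [c|k|a r ain|g h eg [g' eg' gE] eh [h' eh' hE]|g h eg [g' eg' gE] eh [h' eh' hE]].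
- by exists (fun=> 0) => [|p _]; [exact: elementary_cst|by have [_ ->] := is_derive_cst c p w].
- exists (fun=> coord k w) => [|p _]; first exact: elementary_cst.
  by have [_ ->] := is_derive_coord k p w.
- exists (fun p => r * (coord 8 p + a) `^ (r - 1) * coord 8 w) => [|p Up].
    by do 3?[apply: elementary_mul|exact: elementary_cst|exact: elementary_powR].
  by have [_ ->] := is_derive_powR_coord r w (heis_domain_gt0 ain Up).
- exists (fun p => g' p + h' p) => [|p Up]; first exact: elementary_add.
  by rewrite -gE // -hE // -deriveD //; exact/diff_derivable/elementary_diff.
- exists (fun p => g p * h' p + h p * g' p) => [|p Up].
    by apply: elementary_add; apply: elementary_mul.
  rewrite -gE // -hE // -[_ * _]/(_ *: _) -[h p * _]/(_ *: _) -deriveM //;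
  exact/diff_derivable/elementary_diff.
Qed.

Lemma elementary_smooth f g : elementary g -> (forall p, U p -> f p = g p) -> smooth U f.
Proof.
exact: (smooth_of_class open_heis_domain (@elementary_diff) (@elementary_derive)).
Qed.

Definition elementary_mx m n (A : E -> 'M[R]_(m, n)) : Prop :=
  forall i j, elementary (fun p => A p i j).

Lemma elementary_sum n (f : 'I_n -> E -> R) :
  (forall i, elementary (f i)) -> elementary (fun p => \sum_i f i p).
Proof.
elim: n f => [|n IH] f ef.
  rewrite (_ : (fun _ => _) = fun=> 0); first exact: elementary_cst.
  by apply/funext => p; rewrite big_ord0.
rewrite (_ : (fun _ => _) = fun p => f ord0 p + \sum_(i < n) f (lift ord0 i) p).
  exact/elementary_add/IH.
by apply/funext => p; rewrite big_ord_recl.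
Qed.

Lemma elementary_mulmx m n k (A : E -> 'M[R]_(m, n)) (B : E -> 'M[R]_(n, k)) :
  elementary_mx A -> elementary_mx B -> elementary_mx (fun p => A p *m B p).
Proof.
move=> eA eB i j; rewrite (_ : (fun _ => _) = fun p => \sum_l A p i l * B p l j).
  by apply: elementary_sum => l; apply: elementary_mul.
by apply/funext => p; rewrite mxE.
Qed.

(** * The orthonormal coframe and the quaternionic structure *)

Definition monomial (r1 r2 r3 : R) (p : E) : R :=
  (coord 8 p + a1) `^ r1 * (coord 8 p + a2) `^ r2 * (coord 8 p + a3) `^ r3.

Definition kappa : R := Num.sqrt (6 / C).

(** The factors A (four times), B_1, B_2, B_3 and D of the coframe. *)
Definition scale (i : 'I_8) : E -> R :=
  let A p := Num.sqrt C * monomial 18^-1 18^-1 18^-1 p in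
  nth (fun=> 0) [:: A; A; A; A;
    fun p => kappa * monomial (- (5 / 9)) (4 / 9) (4 / 9) p;
    fun p => kappa * monomial (4 / 9) (- (5 / 9)) (4 / 9) p;
    fun p => kappa * monomial (4 / 9) (4 / 9) (- (5 / 9)) p;
    fun p => (kappa ^+ 3)^-1 * monomial (- 3^-1) (- 3^-1) (- 3^-1) p] i.

(** The part of the left invariant coframe which depends on the base point. *)
Definition twist (p : E) (i : 'I_8) : 'rV[R]_8 :=
  nth 0 [:: 0; 0; 0; 0;
    (2 * coord 1 p) *: dx R 2 + (2 * coord 3 p) *: dx R 4;
    (2 * coord 1 p) *: dx R 3 + (2 * coord 4 p) *: dx R 2;
    (2 * coord 1 p) *: dx R 4 + (2 * coord 2 p) *: dx R 3; 0] i.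

Definition theta (p : E) (i : 'I_8) : 'rV[R]_8 :=
  nth 0 [:: dx R 1; dx R 2; dx R 3; dx R 4; eta1 p; eta2 p; eta3 p; dx R 8] i.

Definition twist_mx (p : E) : 'M[R]_8 := \matrix_i twist p i.

Definition coframe (p : E) : 'M[R]_8 :=
  diag_mx (\row_i scale i p) *m (1%:M + twist_mx p).

(** The dual frame; the twist squares to zero, so 1 - twist inverts 1 + twist. *)
Definition frame (p : E) : 'M[R]_8 :=
  (1%:M - twist_mx p) *m diag_mx (\row_i (scale i p)^-1).

Definition heis_J (s : 'I_3) (p : E) : 'M[R]_8 :=
  frame p *m quat_unit R s *m coframe p.

(** The twist sends the positions 4 to 6 to the positions 1 to 3 and kills the
    latter. *)
Lemma twist_mx_sq p : twist_mx p *m twist_mx p = 0.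
Proof.
apply/matrixP => i j; rewrite !mxE big1 // => k _; rewrite !mxE.
have [k4|k4] := ltnP k 4.
  by rewrite (_ : twist p k = 0) ?mxE ?mulr0 //; case: k k4 => [[|[|[|[|]]]]].
rewrite (_ : twist p i 0 k = 0) ?mul0r //.
have dx0 n : (n < 5)%N -> dx R n 0 k = 0.
  rewrite mxE eqxx /= => n5; case: eqP => // kE.
  by move: k4; rewrite kE inordK; case: n n5 {kE} => [|[|[|[|[|]]]]].
case: i => [[|[|[|[|[|[|[|[|i]]]]]]]] //= ?]; rewrite /twist /= ?[LHS]mxE //;
 by rewrite [X in X + _]mxE [X in _ + X]mxE !dx0 // !mulr0 addr0.
Qed.

Lemma row_coframe p i : row i (coframe p) = scale i p *: theta p i.
Proof.
have dxE k (lt : (k < 8)%N) (j0 : 'I_8) : (Ordinal lt == j0)%:R = dx R k.+1 0 j0 :> R.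
  have -> : Ordinal lt = inord k by apply: val_inj; rewrite /= inordK.
  by rewrite mxE eqxx /= eq_sym.
rewrite /coframe mul_diag_mx; apply/rowP => j; rewrite !mxE; congr (_ * _).
case: i => [[|[|[|[|[|[|[|[|i]]]]]]]] //= lti];
  rewrite dxE /twist /theta /eta1 /eta2 /eta3 /= -?addrA.
all: rewrite ?[X in _ + X]mxE ?addr0 //; rewrite ?[RHS]mxE ?[X in _ = _ + X]mxE //.
Qed.

Lemma coframeE p i j : coframe p i j = scale i p * theta p i 0 j.
Proof. by have := congr1 (fun t : 'rV[R]_8 => t 0 j) (row_coframe p i); rewrite !mxE. Qed.

Lemma kappa_gt0 : 0 < kappa.
Proof. by rewrite sqrtr_gt0 divr_gt0. Qed.

Lemma kappa_sq : kappa ^+ 2 = 6 / C.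
Proof. by rewrite sqr_sqrtr // ltW // divr_gt0. Qed.

Lemma monomial_gt0 r1 r2 r3 p : U p -> 0 < monomial r1 r2 r3 p.
Proof. by case=> p1 p2 p3; rewrite !mulr_gt0 ?powR_gt0. Qed.

Lemma monomialM r1 r2 r3 s1 s2 s3 p : U p ->
  monomial r1 r2 r3 p * monomial s1 s2 s3 p = monomial (r1 + s1) (r2 + s2) (r3 + s3) p.
Proof.
case=> p1 p2 p3.
have powRD' (x r s : R) : 0 < x -> x `^ (r + s) = x `^ r * x `^ s.
  by move=> x0; rewrite powRD // (gt_eqF x0) implybT.
by rewrite /monomial !powRD' //; ring.
Qed.

Lemma monomialV r1 r2 r3 p : (monomial r1 r2 r3 p)^-1 = monomial (- r1) (- r2) (- r3) p.
Proof. by rewrite /monomial !powRN !invfM. Qed.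

Lemma scale_gt0 p i : U p -> 0 < scale i p.
Proof.
move=> Up; have k0 := kappa_gt0; have sC : 0 < Num.sqrt C by rewrite sqrtr_gt0.
by case: i => [[|[|[|[|[|[|[|[|i]]]]]]]] //= lti];
  rewrite /scale /= mulr_gt0 ?monomial_gt0 // invr_gt0 exprn_gt0.
Qed.

Lemma frameK p : U p -> frame p *m coframe p = 1%:M.
Proof.
move=> Up; apply: mulmx1C; rewrite /coframe /frame mulmxA -[_ *m _ *m (_ - _)]mulmxA.
rewrite mulmxBr mulmx1 mulmxDl mul1mx twist_mx_sq addr0 addrK mulmx1 mulmx_diag.
apply/matrixP => i j; rewrite !mxE; case: eqP => //= _.
by rewrite mulfV // gt_eqF // scale_gt0.
Qed.

Lemma powR_monomial3 r p : U p ->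
  ((coord 8 p + a1) * (coord 8 p + a2) * (coord 8 p + a3)) `^ r = monomial r r r p.
Proof. by case=> p1 p2 p3; rewrite !powRM ?mulr_ge0 // ltW. Qed.

Lemma powR_eighths (x y z : R) : 0 < x -> 0 < y -> 0 < z ->
  (y ^+ 8 * z ^+ 8 / x ^+ 10) `^ (1 / 9) =
  (y `^ (4 / 9) * z `^ (4 / 9) * x `^ (- (5 / 9))) ^+ 2.
Proof.
move=> x0 y0 z0.
have powX (w : R) n : 0 < w -> (w ^+ n) `^ (1 / 9) = w `^ (n%:R / 9).
  by move=> w0; rewrite -powR_mulrn ?ltW // -powRrM mul1r.
have powV (w : R) : 0 < w -> w^-1 `^ (1 / 9) = (w `^ (1 / 9))^-1.
  by move=> w0; rewrite -(powR_inv1 (ltW w0)) powRAC powR_inv1 ?powR_ge0.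
rewrite powRM ?invr_ge0 ?mulr_ge0 ?exprn_ge0 ?ltW // powRM ?exprn_ge0 ?ltW //.
rewrite powV ?exprn_gt0 // !powX //.
rewrite !exprMn -!powR_mulrn ?powR_ge0 // -!powRrM -powRN.
by congr (_ `^ _ * _ `^ _ * _ `^ _); field.
Qed.

Lemma scale_base_sq p : U p ->
  (Num.sqrt C * monomial 18^-1 18^-1 18^-1 p) ^+ 2 = C * monomial (1 / 9) (1 / 9) (1 / 9) p.
Proof.
move=> Up; rewrite exprMn sqr_sqrtr ?ltW // expr2 monomialM //.
by congr (_ * monomial _ _ _ _); field.
Qed.

Lemma scale_line_sq p : U p ->
  ((kappa ^+ 3)^-1 * monomial (- 3^-1) (- 3^-1) (- 3^-1) p) ^+ 2 =
  (C / 6) ^+ 3 / monomial (2 / 3) (2 / 3) (2 / 3) p.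
Proof.
move=> Up; rewrite exprMn exprVn exprAC kappa_sq // -exprVn invf_div monomialV.
rewrite expr2 monomialM //.
by congr (_ * monomial _ _ _ _); field.
Qed.

Lemma heis_metricE p : U p -> g p = (coframe p)^T *m coframe p.
Proof.
move=> Up; have [p1 p2 p3] := Up.
apply/matrixP => i j; rewrite [RHS]mxE.
under eq_bigr do rewrite mxE !coframeE.
have sq_ij (t : 'rV[R]_8) : sym_sq t i j = t 0 i * t 0 j by rewrite mxE big_ord1 mxE.
rewrite /heis_metric !powR_eighths // !powR_monomial3 //.
rewrite !big_ord_recl big_ord0 /scale /theta /=.
have addE (A B : 'M[R]_8) : (A + B) i j = A i j + B i j by rewrite mxE.
have scaleE c (A : 'M[R]_8) : (c *: A) i j = c * A i j by rewrite mxE.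
rewrite !(addE, scaleE, sq_ij) -kappa_sq // -scale_base_sq // -scale_line_sq //.
by rewrite /monomial; ring.
Qed.

Lemma elementary_monomial r1 r2 r3 : elementary (monomial r1 r2 r3).
Proof.
have eP a r : a \in [:: a1; a2; a3] -> elementary (fun p => (coord 8 p + a) `^ r).
  exact: elementary_powR.
by apply: (elementary_mul (elementary_mul (eP _ _ _) (eP _ _ _)) (eP _ _ _));
  rewrite !inE eqxx ?orbT.
Qed.

Lemma elementary_scale i : elementary (scale i).
Proof.
case: i => [[|[|[|[|[|[|[|[|i]]]]]]]] //= lti]; rewrite /scale /=;
  apply: elementary_mul; by [exact: elementary_cst|exact: elementary_monomial].
Qed.

Lemma elementary_scaleV i : elementary (fun p => (scale i p)^-1).
Proof.
have eV c r1 r2 r3 : elementary (fun p => (c * monomial r1 r2 r3 p)^-1).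
  rewrite (_ : (fun _ => _) = fun p => c^-1 * monomial (- r1) (- r2) (- r3) p).
    by apply: elementary_mul; [exact: elementary_cst|exact: elementary_monomial].
  by apply/funext => p; rewrite invfM monomialV.
by case: i => [[|[|[|[|[|[|[|[|i]]]]]]]] //= lti]; exact: eV.
Qed.

Lemma elementary_mx_cst m n (A : 'M[R]_(m, n)) : elementary_mx (fun=> A).
Proof. by move=> i j; exact: elementary_cst. Qed.

Lemma elementary_mx_diag n (f : 'I_n -> E -> R) : (forall i, elementary (f i)) ->
  elementary_mx (fun p => diag_mx (\row_i f i p)).
Proof.
move=> ef i j; rewrite (_ : (fun _ => _) = fun p => f i p * (i == j)%:R).
  exact/elementary_mul/elementary_cst.
by apply/funext => p; rewrite !mxE mulr_natr.
Qed.

Lemma elementary_mx_twist : elementary_mx twist_mx.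
Proof.
have e2 k l (d d' : 'rV[R]_8) j :
  elementary (fun p => ((2 * coord k p) *: d + (2 * coord l p) *: d') 0 j).
  rewrite (_ : (fun _ => _) = fun p => 2 * d 0 j * coord k p + 2 * d' 0 j * coord l p).
    apply: elementary_add; apply: elementary_mul;
    by [exact: elementary_cst|exact: elementary_coord].
  by apply/funext => p; rewrite !mxE; ring.
move=> i j; rewrite (_ : (fun _ => _) = fun p => twist p i 0 j); last first.
  by apply/funext => p; rewrite mxE.
case: i => [[|[|[|[|[|[|[|[|i]]]]]]]] //= lti]; rewrite /twist /=; try exact: e2.
all: rewrite (_ : (fun _ => _) = fun=> 0); first exact: elementary_cst.
all: by apply/funext => p; rewrite mxE.
Qed.

Lemma elementary_mx_add m n (A B : E -> 'M[R]_(m, n)) :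
  elementary_mx A -> elementary_mx B -> elementary_mx (fun p => A p + B p).
Proof.
move=> eA eB i j; rewrite (_ : (fun _ => _) = fun p => A p i j + B p i j).
  exact: elementary_add.
by apply/funext => p; rewrite mxE.
Qed.

Lemma elementary_coframe : elementary_mx coframe.
Proof.
apply: elementary_mulmx; first exact/elementary_mx_diag/elementary_scale.
by apply: elementary_mx_add; [exact: elementary_mx_cst|exact: elementary_mx_twist].
Qed.

Lemma elementary_frame : elementary_mx frame.
Proof.
apply: elementary_mulmx; last exact/elementary_mx_diag/elementary_scaleV.
apply: elementary_mx_add; first exact: elementary_mx_cst.
move=> i j; rewrite (_ : (fun _ => _) = fun p => -1 * twist_mx p i j).
  by apply: elementary_mul; [exact: elementary_cst|exact: elementary_mx_twist].
by apply/funext => p; rewrite [LHS]mxE mulN1r.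
Qed.

Lemma smooth_heis_J s : smooth_mx U (heis_J s).
Proof.
have eJ : elementary_mx (heis_J s).
  apply: elementary_mulmx; last exact: elementary_coframe.
  by apply: elementary_mulmx; [exact: elementary_frame|exact: elementary_mx_cst].
by move=> i j; exact: (elementary_smooth (eJ i j)).
Qed.

Lemma riemannian_heis_metric : riemannian_metric U g.
Proof.
split.
  have eg : elementary_mx (fun p => (coframe p)^T *m coframe p).
    apply: elementary_mulmx; last exact: elementary_coframe.
    move=> i j; rewrite (_ : (fun _ => _) = fun p => coframe p j i).
      exact: elementary_coframe.
    by apply/funext => p; rewrite mxE.
  move=> i j; apply: (elementary_smooth (eg i j)) => p Up.
  by rewrite heis_metricE.
move=> p Up; rewrite heis_metricE //; split; first by rewrite trmx_mul trmxK.
move=> X X0; rewrite /inner mulmxA -trmx_mul -mulmxA mxE.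
have PX0 : coframe p *m X != 0.
  apply: contraNneq X0 => PX; have := congr1 (mulmx (frame p)) PX.
  by rewrite mulmxA frameK // mul1mx mulmx0 => ->.
have PXge0 i : 0 <= (coframe p *m X)^T 0 i * (coframe p *m X) i 0.
  by rewrite mxE -expr2 sqr_ge0.
rewrite lt_neqAle sumr_ge0 ?andbT // eq_sym psumr_neq0 //.
apply: contraNT PX0 => /hasPn PX; apply/eqP/colP => i; rewrite [RHS]mxE.
have := PX i (mem_index_enum _); rewrite /= lt_neqAle PXge0 andbT negbK eq_sym.
by rewrite [(_)^T _ _]mxE mulf_eq0 orbb => /eqP.
Qed.

Lemma heis_J_mul s t p : U p ->
  heis_J s p *m heis_J t p = frame p *m (quat_unit R s *m quat_unit R t) *m coframe p.
Proof.
move=> Up; have PK : coframe p *m frame p = 1%:M by apply/mulmx1C/frameK.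
rewrite /heis_J; move: (coframe p) (frame p) PK => P F PK.
by rewrite -!mulmxA (mulmxA P F) PK mul1mx.
Qed.

Lemma coframe_heis_J s p (x : E) : U p ->
  coframe p *m (heis_J s p *m x) = quat_unit R s *m (coframe p *m x).
Proof.
move=> Up; have PK : coframe p *m frame p = 1%:M by apply/mulmx1C/frameK.
rewrite /heis_J; move: (coframe p) (frame p) PK => P F PK.
by rewrite !mulmxA PK mul1mx.
Qed.

Lemma inner_heis p (x y : E) : U p ->
  inner (g p) x y = ((coframe p *m x)^T *m (coframe p *m y)) 0 0.
Proof.
move=> Up; rewrite /inner heis_metricE //; move: (coframe p) => P.
by rewrite trmx_mul !mulmxA.
Qed.

Definition heis_Q (p : E) : {vspace 'M[R]_8} :=
  <<[:: heis_J 0%R p; heis_J 1%R p; heis_J 2%R p]>>%VS.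

Lemma heis_quaternionic_frame :
  quaternionic_frame U g heis_Q (heis_J 0) (heis_J 1) (heis_J 2%R).
Proof.
split; [exact: smooth_heis_J|exact: smooth_heis_J|exact: smooth_heis_J|].
move=> p Up; have JJ s : heis_J s p *m heis_J s p = - 1%:M.
  by rewrite heis_J_mul // quat_unit_sq mulmxN mulNmx mulmx1 frameK.
have gJ s (x y : E) : inner (g p) (heis_J s p *m x) (heis_J s p *m y) =
    inner (g p) x y.
  rewrite !inner_heis // !coframe_heis_J // trmx_mul tr_quat_unit mulmxA.
  rewrite -[_ *m _ *m quat_unit R s]mulmxA mulNmx quat_unit_sq opprK mulmx1.
  by [].
by split=> //; rewrite !heis_J_mul // quat_unit12 quat_unit21 mulmxN mulNmx.
Qed.

(** Half of the derivative along w of the left invariant forms at the vector x: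
    the forms are affine in the base point. *)
Definition twist_form (s : 'I_3) (w x : E) : R :=
  nth 0 [:: coord 1 w * coord 2 x + coord 3 w * coord 4 x;
            coord 1 w * coord 3 x + coord 4 w * coord 2 x;
            coord 1 w * coord 4 x + coord 2 w * coord 3 x] s.

(** dx_12 + dx_34, dx_13 + dx_42 and dx_14 + dx_23. *)
Definition omega (s : 'I_3) : E -> E -> R := skew (twist_form s).

Definition eta (p : E) (s : 'I_3) (x : E) : R := coord (s + 5) x + 2 * twist_form s p x.

Definition height (p : E) (s : 'I_3) : R := coord 8 p + nth 0 [:: a1; a2; a3] s.

Definition fibre_scale (s : 'I_3) (p : E) : R := scale (inord (s + 4)) p.

Lemma dx_mul k (x : E) : (dx R k *m x) 0 0 = coord k x.
Proof. by rewrite /dx -rowE mxE. Qed.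

Lemma coframe_mul p (x : E) i :
  (coframe p *m x) i 0 = scale i p * (theta p i *m x) 0 0.
Proof.
have -> : (coframe p *m x) i 0 = (row i (coframe p) *m x) 0 0.
  by rewrite -row_mul [RHS]mxE.
by rewrite row_coframe -scalemxAl mxE.
Qed.

Lemma theta_eta p (s : 'I_3) (x : E) : (theta p (inord (s + 4)) *m x) 0 0 = eta p s x.
Proof.
have mxD (A B : 'M[R]_1) : (A + B) 0 0 = A 0 0 + B 0 0 by rewrite mxE.
have mxZ c (A : 'M[R]_1) : (c *: A) 0 0 = c * A 0 0 by rewrite mxE.
case: s => [[|[|[|]]]] //= lt; rewrite /theta inordK //= /eta1 /eta2 /eta3;
  by rewrite !mulmxDl !mxD -!scalemxAl !mxZ !dx_mul /eta /twist_form /=; ring.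
Qed.

Lemma theta_coord p (x : E) k : (k < 4)%N || (k == 7)%N ->
  (theta p (inord k) *m x) 0 0 = coord k.+1 x.
Proof.
by case: k => [|[|[|[|[|[|[|[|k]]]]]]]] // _; rewrite /theta inordK //= dx_mul.
Qed.

Lemma scale_base p k : (k < 4)%N -> scale (inord k) p = scale 0 p.
Proof. by case: k => [|[|[|[|k]]]] // _; rewrite /scale inordK. Qed.

Lemma coframe_coords p (x : E) :
  let Px k := (coframe p *m x) (inord k) 0 in
  (Px 0%N = scale 0 p * coord 1 x) * (Px 1%N = scale 0 p * coord 2 x)
  * (Px 2%N = scale 0 p * coord 3 x) * (Px 3%N = scale 0 p * coord 4 x)
  * (Px 4%N = fibre_scale 0 p * eta p 0 x) * (Px 5%N = fibre_scale 1 p * eta p 1 x)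
  * (Px 6%N = fibre_scale 2%R p * eta p 2%R x) * (Px 7%N = scale (inord 7) p * coord 8 x).
Proof.
move=> Px; rewrite {}/Px !coframe_mul.
rewrite (theta_eta p 0) (theta_eta p 1) (theta_eta p 2%R).
rewrite (@theta_coord p x 0) // (@theta_coord p x 1) // (@theta_coord p x 2) //.
rewrite (@theta_coord p x 3) // (@theta_coord p x 7) //.
by rewrite (@scale_base p 0) // (@scale_base p 1) // (@scale_base p 2) // (@scale_base p 3).
Qed.

(** In the orthonormal coframe the Kaehler form is the signed permutation itself;
    its eight terms pair up into these four elementary 2-forms. *)
Lemma kahler_formE s p (x y : E) : U p ->
  inner (g p) (heis_J s p *m x) y =
  scale 0 p ^+ 2 * omega s x y
  + scale (inord 7) p * fibre_scale s p * wedge11 (coord 8) (eta p s) x y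
  + fibre_scale (s + 1) p * fibre_scale (s + 2) p * wedge11 (eta p (s + 1)) (eta p (s + 2)) x y.
Proof.
move=> Up; rewrite inner_heis // coframe_heis_J // mxE.
under eq_bigr do rewrite mxE signed_perm_mxE.
rewrite big_ord8 /quat_sign /quat_perm /table_fun !inordK //.
move: s; apply: ord3_ind; rewrite !ord3D !ord3_val /= !coframe_coords;
  by rewrite /wedge11 /omega /skew /twist_form /=; ring.
Qed.

(** * The fundamental form *)

Definition alpha (p : E) : R := C ^+ 2 * monomial (2 / 9) (2 / 9) (2 / 9) p.

Lemma height_gt0 p s : U p -> 0 < height p s.
Proof. by move=> [p1 p2 p3]; move: s; apply: ord3_ind. Qed.

(** All the coefficients are rational functions of the ninth roots of the u + a_s,
    which turns identities between real powers into field identities. *)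
Lemma powR_ninths (x : R) : 0 < x -> exists2 y : R, y != 0 &
  [/\ x `^ (4 / 9) = y ^+ 4, x `^ (- (5 / 9)) = y ^- 5, x `^ (- 3^-1) = y ^- 3 &
      x `^ 9^-1 = y /\ x `^ (2 / 9) = y ^+ 2 /\ x = y ^+ 9].
Proof.
move=> x0; exists (x `^ 9^-1); first by rewrite gt_eqF // powR_gt0.
rewrite -!powR_invn ?powR_ge0 // -!powR_mulrn ?powR_ge0 // -!powRrM.
split; try by congr (_ `^ _); field.
by split=> //; split; [congr (_ `^ _); field|rewrite mulVf ?powRr1 ?ltW // pnatr_eq0].
Qed.

(** The exponents 1/9, 4/9 and 1/3 in the metric are exactly those for which the
    third product is proportional to u + a_s and the fourth one is constant. *)
Lemma coefficients p s : U p ->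
  let A2 := scale 0 p ^+ 2 in
  let DB := scale (inord 7) p * fibre_scale s p in
  let BB := fibre_scale (s + 1) p * fibre_scale (s + 2) p in
  [/\ A2 ^+ 2 = alpha p, 2 * (A2 * DB) = alpha p / (3 * height p s),
      2 * (A2 * BB) = 12 * height p s & 2 * (DB * BB) = 2].
Proof.
move=> Up /=; have [p1 p2 p3] := Up; have k0 := kappa_gt0.
have CE : C = 6 / kappa ^+ 2 by rewrite kappa_sq // invf_div mulrC divfK // pnatr_eq0.
have -> : scale 0 p ^+ 2 = C * monomial 9^-1 9^-1 9^-1 p.
  by rewrite -[9^-1]mul1r -scale_base_sq.
have -> : scale (inord 7) p =
    (kappa ^+ 3)^-1 * monomial (- 3^-1) (- 3^-1) (- 3^-1) p.
  by rewrite /scale inordK.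
rewrite /alpha /height.
have v0 : fibre_scale 0 p = kappa * monomial (- (5 / 9)) (4 / 9) (4 / 9) p.
  by rewrite /fibre_scale /scale inordK.
have v1 : fibre_scale 1 p = kappa * monomial (4 / 9) (- (5 / 9)) (4 / 9) p.
  by rewrite /fibre_scale /scale inordK.
have v2 : fibre_scale 2%R p = kappa * monomial (4 / 9) (4 / 9) (- (5 / 9)) p.
  by rewrite /fibre_scale /scale inordK.
have [x x0 [x4 x5 x3 [x1 [x2 x9]]]] := powR_ninths p1.
have [y y0 [y4 y5 y3 [y1 [y2 y9]]]] := powR_ninths p2.
have [z z0 [z4 z5 z3 [z1 [z2 z9]]]] := powR_ninths p3.
have {}k0 : kappa != 0 by rewrite gt_eqF.
move: s; apply: ord3_ind; rewrite !ord3D !ord3_val /= ?v0 ?v1 ?v2 /monomial.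
all: rewrite ?x1 ?x2 ?x3 ?x4 ?x5 ?y1 ?y2 ?y3 ?y4 ?y5 ?z1 ?z2 ?z3 ?z4 ?z5 ?x9 ?y9 ?z9.
all: move: kappa k0 CE => k k0 ->.
all: split; field; rewrite ?x0 ?y0 ?z0 ?k0 //.
Qed.

Definition base_part (s : 'I_3) : E -> E -> E -> E -> R := wedge22 (omega s) (omega s).
Definition line_part (p : E) (s : 'I_3) : E -> E -> E -> E -> R :=
  wedge22 (omega s) (wedge11 (coord 8) (eta p s)).
Definition fibre_part (p : E) (s : 'I_3) : E -> E -> E -> E -> R :=
  wedge22 (omega s) (wedge11 (eta p (s + 1)) (eta p (s + 2))).
Definition vertical_part (p : E) (s : 'I_3) : E -> E -> E -> E -> R :=
  wedge22 (wedge11 (coord 8) (eta p s)) (wedge11 (eta p (s + 1)) (eta p (s + 2))).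

Definition phi (p x y z t : E) : R :=
  \sum_(s < 3) (alpha p * base_part s x y z t
    + alpha p / (3 * height p s) * line_part p s x y z t
    + 12 * height p s * fibre_part p s x y z t
    + 2 * vertical_part p s x y z t).

Definition heis_Phi : diff_form R 7 4 :=
  fun p v => phi p (v 0) (v 1) (v 2%R) (v 3%R).

Lemma wedge_kahler_heis s p v : U p ->
  wedge (kahler_form g (heis_J s))
        (kahler_form g (heis_J s)) p v =
  alpha p * base_part s (v 0) (v 1) (v 2%R) (v 3%R)
    + alpha p / (3 * height p s) * line_part p s (v 0) (v 1) (v 2%R) (v 3%R)
    + 12 * height p s * fibre_part p s (v 0) (v 1) (v 2%R) (v 3%R)
    + 2 * vertical_part p s (v 0) (v 1) (v 2%R) (v 3%R).
Proof.
move=> Up; pose F x y := inner (g p) (heis_J s p *m x) y.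
have FE x y := kahler_formE s x y Up.
have FN x y : F x y = - F y x by rewrite /F !FE /omega /skew /wedge11; ring.
rewrite (@wedge_wedge22 _ _ F F) // (wedge22_sum FE).
by have [-> -> -> ->] := coefficients s Up.
Qed.

Lemma heis_Phi_fundamental :
  is_fundamental_form U g heis_Q heis_Phi.
Proof.
move=> V J1 J2 J3 oV VU [_ _ _ qJ] p v Vp; have Up := VU p Vp.
have [[J11 J22 J33] [J12 J21] _ QJ] := qJ p Vp.
have [_ _ _ /(_ p Up) [[H11 H22 H33] [H12 H21] _ QH]] := heis_quaternionic_frame.
pose J := [tuple J1; J2; J3].
have [] := @span_rotation R 7 [tuple heis_J 0 p; heis_J 1 p; heis_J 2%R p] [tuple J1 p; J2 p; J3 p].
- exact: clifford_of_quaternions.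
- exact: clifford_of_quaternions.
- by rewrite /= -QJ QH.
move=> m mm JE.
transitivity (\sum_s wedge (kahler_form g (tnth J s)) (kahler_form g (tnth J s)) p v); last first.
  by rewrite big_ord3.
rewrite (@sum_wedge_squares _ _ _ (fun s => kahler_form g (heis_J s))).
  by apply: eq_bigr => s _; rewrite wedge_kahler_heis.
have tJ s : tnth J s p = \sum_t m s t *: heis_J t p.
  transitivity (tnth [tuple J1 p; J2 p; J3 p] s).
    by move: s; apply: ord3_ind.
  by rewrite JE; apply: eq_bigr; apply: ord3_ind.
have FJ s x y : inner (g p) (tnth J s p *m x) y =
    \sum_t m s t * inner (g p) (heis_J t p *m x) y.
  rewrite tJ mulmx_suml /inner linear_sum !mulmx_suml summxE; apply: eq_bigr => t _.
  by rewrite -scalemxAl linearZ -!scalemxAl mxE.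
by move=> u w; apply: (sum_products_rotation mm) => s; exact: FJ.
Qed.

(** * Closedness *)

(* The primed parts are half the directional derivatives of the parts along w,
   alpha' is the derivative of alpha in u, and phi' that of phi along w. *)

Definition line_part' (w : E) (s : 'I_3) : E -> E -> E -> E -> R :=
  wedge22 (omega s) (wedge11 (coord 8) (twist_form s w)).

Definition fibre_part' (p w : E) (s : 'I_3) (x y z t : E) : R :=
  wedge22 (omega s) (wedge11 (twist_form (s + 1) w) (eta p (s + 2))) x y z t
  + wedge22 (omega s) (wedge11 (eta p (s + 1)) (twist_form (s + 2) w)) x y z t.

Definition vertical_part' (p w : E) (s : 'I_3) (x y z t : E) : R :=
  wedge22 (wedge11 (coord 8) (twist_form s w)) (wedge11 (eta p (s + 1)) (eta p (s + 2))) x y z t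
  + wedge22 (wedge11 (coord 8) (eta p s)) (wedge11 (twist_form (s + 1) w) (eta p (s + 2))) x y z t
  + wedge22 (wedge11 (coord 8) (eta p s)) (wedge11 (eta p (s + 1)) (twist_form (s + 2) w)) x y z t.

Definition alpha' (p : E) : R := alpha p * (2 / 9 * \sum_s (height p s)^-1).

Definition phi' (p w x y z t : E) : R :=
  \sum_(s < 3) (alpha' p * coord 8 w * base_part s x y z t
    + (alpha' p / (3 * height p s) - alpha p / (3 * height p s ^+ 2)) * coord 8 w
      * line_part p s x y z t
    + alpha p / (3 * height p s) * (2 * line_part' w s x y z t)
    + 12 * coord 8 w * fibre_part p s x y z t
    + 12 * height p s * (2 * fibre_part' p w s x y z t)
    + 4 * vertical_part' p w s x y z t).

Lemma is_derive_eta (p w : E) s (x : E) :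
  is_derive p w (fun q : E => eta q s x) (2 * twist_form s w x).
Proof.
have db k : is_derive p w (fun q : E => coord k q) (coord k w) := is_derive_coord k p w.
have h k l c d : is_derive p w (fun q : E => coord (s + 5) x + 2 * (coord k q * c + coord l q * d))
    (2 * (coord k w * c + coord l w * d)).
  have h0 := is_derive_fun_add (is_derive_fun_mul (db k) (is_derive_fun_cst p w c))
    (is_derive_fun_mul (db l) (is_derive_fun_cst p w d)).
  have h1 := is_derive_fun_add (is_derive_fun_cst p w (coord (s + 5) x))
    (is_derive_fun_mul (is_derive_fun_cst p w 2) h0).
  by apply: (is_derive_eq h1); ring.
by move: s h; apply: ord3_ind => h; exact: h.
Qed.

Lemma is_derive_height p w s : is_derive p w (height ^~ s) (coord 8 w).
Proof.
have h := is_derive_fun_add (is_derive_coord 8 p w)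
  (is_derive_fun_cst p w (nth 0 [:: a1; a2; a3] s)).
by apply: (is_derive_eq h); rewrite addr0.
Qed.

Lemma is_derive_monomial p w r1 r2 r3 : U p ->
  is_derive p w (monomial r1 r2 r3)
    (monomial r1 r2 r3 p *
     (r1 / (coord 8 p + a1) + r2 / (coord 8 p + a2) + r3 / (coord 8 p + a3)) * coord 8 w).
Proof.
move=> [p1 p2 p3].
have dP a r : 0 < coord 8 p + a -> is_derive p w (fun q => (coord 8 q + a) `^ r)
    ((coord 8 p + a) `^ r * (r / (coord 8 p + a)) * coord 8 w).
  move=> pa; apply: (is_derive_eq (is_derive_powR_coord _ _ pa)).
  rewrite powRB ?(gt_eqF pa) ?implybT // powRr1 ?ltW //.
  by field; rewrite gt_eqF.
have h := is_derive_fun_mul (is_derive_fun_mul (dP _ r1 p1) (dP _ r2 p2)) (dP _ r3 p3).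
by apply: (is_derive_eq h); rewrite /monomial; ring.
Qed.

Lemma is_derive_alpha p w : U p -> is_derive p w alpha (alpha' p * coord 8 w).
Proof.
move=> Up.
have h := is_derive_fun_mul (is_derive_fun_cst p w (C ^+ 2))
  (is_derive_monomial w (2 / 9) (2 / 9) (2 / 9) Up).
by apply: (is_derive_eq h); rewrite /alpha' big_ord3 /alpha /height /=; ring.
Qed.

Lemma is_derive_line_part (p w : E) s (x y z t : E) :
  is_derive p w (fun q => line_part q s x y z t) (2 * line_part' w s x y z t).
Proof.
have dS u v : is_derive p w (fun q => wedge11 (coord 8) (eta q s) u v)
    (2 * wedge11 (coord 8) (twist_form s w) u v).
  have h := @is_derive_wedge11 _ _ p w _ (fun _ => coord 8) (fun q => eta q s) _ _ u v
    (fun x => is_derive_fun_cst p w (coord 8 x)) (is_derive_eta p w s).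
  by apply: (is_derive_eq h); rewrite /wedge11; ring.
have h := @is_derive_wedge22 _ _ p w _ (fun _ => omega s)
  (fun q => wedge11 (coord 8) (eta q s)) _ _ x y z t
  (fun x y => is_derive_fun_cst p w (omega s x y)) dS.
by apply: (is_derive_eq h); rewrite /line_part' /wedge22; ring.
Qed.

Lemma is_derive_fibre2 (p w : E) s (u v : E) :
  is_derive p w (fun q => wedge11 (eta q (s + 1)) (eta q (s + 2)) u v)
    (2 * (wedge11 (twist_form (s + 1) w) (eta p (s + 2)) u v
          + wedge11 (eta p (s + 1)) (twist_form (s + 2) w) u v)).
Proof.
have h := @is_derive_wedge11 _ _ p w _ _ _ _ _ u v
  (is_derive_eta p w (s + 1)) (is_derive_eta p w (s + 2)).
by apply: (is_derive_eq h); rewrite /wedge11; ring.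
Qed.

Lemma is_derive_fibre_part (p w : E) s (x y z t : E) :
  is_derive p w (fun q => fibre_part q s x y z t) (2 * fibre_part' p w s x y z t).
Proof.
have h := @is_derive_wedge22 _ _ p w _ (fun _ => omega s)
  (fun q => wedge11 (eta q (s + 1)) (eta q (s + 2))) _ _ x y z t
  (fun x y => is_derive_fun_cst p w (omega s x y)) (is_derive_fibre2 p w s).
by apply: (is_derive_eq h); rewrite /fibre_part' /wedge22; ring.
Qed.

Lemma is_derive_vertical_part (p w : E) s (x y z t : E) :
  is_derive p w (fun q => vertical_part q s x y z t) (2 * vertical_part' p w s x y z t).
Proof.
have dS u v : is_derive p w (fun q => wedge11 (coord 8) (eta q s) u v)
    (2 * wedge11 (coord 8) (twist_form s w) u v).
  have h := @is_derive_wedge11 _ _ p w _ (fun _ => coord 8) (fun q => eta q s) _ _ u v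
    (fun x => is_derive_fun_cst p w (coord 8 x)) (is_derive_eta p w s).
  by apply: (is_derive_eq h); rewrite /wedge11; ring.
have h := @is_derive_wedge22 _ _ p w _ _ _ _ _ x y z t dS (is_derive_fibre2 p w s).
by apply: (is_derive_eq h); rewrite /vertical_part' /wedge22; ring.
Qed.

Lemma is_derive_phi p w (x y z t : E) : U p ->
  is_derive p w (fun q => phi q x y z t) (phi' p w x y z t).
Proof.
move=> Up; rewrite /phi' /phi.
pose F s q := alpha q * base_part s x y z t
    + alpha q / (3 * height q s) * line_part q s x y z t
    + 12 * height q s * fibre_part q s x y z t
    + 2 * vertical_part q s x y z t.
pose F' s := alpha' p * coord 8 w * base_part s x y z t
    + (alpha' p / (3 * height p s) - alpha p / (3 * height p s ^+ 2)) * coord 8 w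
      * line_part p s x y z t
    + alpha p / (3 * height p s) * (2 * line_part' w s x y z t)
    + 12 * coord 8 w * fibre_part p s x y z t
    + 12 * height p s * (2 * fibre_part' p w s x y z t)
    + 4 * vertical_part' p w s x y z t.
have dF s : is_derive p w (F s) (F' s).
  have v0 : height p s != 0 by rewrite gt_eqF // height_gt0.
  have v30 : 3 * height p s != 0 by rewrite mulf_neq0 ?pnatr_eq0.
  have dk c := is_derive_fun_cst p w c.
  have da := is_derive_alpha w Up.
  have dv := is_derive_height p w s.
  have dvV := @is_derive_fun_inv _ _ p w (fun q => 3 * height q s) _ v30
    (is_derive_fun_mul (dk 3) dv).
  have h := is_derive_fun_add (is_derive_fun_add (is_derive_fun_add
    (is_derive_fun_mul da (dk (base_part s x y z t)))
    (is_derive_fun_mul (is_derive_fun_mul da dvV)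
      (is_derive_line_part p w s x y z t)))
    (is_derive_fun_mul (is_derive_fun_mul (dk 12) dv) (is_derive_fibre_part p w s x y z t)))
    (is_derive_fun_mul (dk 2) (is_derive_vertical_part p w s x y z t)).
  by apply: (is_derive_eq h); rewrite /F'; field.
rewrite (_ : (fun q => _) = fun q => F 0 q + F 1 q + F 2%R q); last first.
  by apply/funext => q; rewrite big_ord3.
by rewrite big_ord3; do 2?[apply: is_derive_fun_add]; exact: dF.
Qed.

Lemma base_part_eq s (x y z t : E) : base_part s x y z t = base_part 0 x y z t.
Proof.
by move: s; apply: ord3_ind => //; rewrite /base_part /wedge22 /omega /skew /twist_form /=; ring.
Qed.

Lemma omega_wedge_omega (s i : 'I_3) (x y z t : E) : i != 0 ->
  wedge22 (omega s) (omega (s + i)) x y z t = 0.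
Proof.
move: s i; apply: ord3_ind; apply: ord3_ind; rewrite ?eqxx // => _;
by rewrite !ord3D /wedge22 /omega /skew /twist_form /=; ring.
Qed.

Lemma alt5_phi' p (x y z t u : E) : U p -> alt5 (phi' p) x y z t u = 0.
Proof.
move=> Up.
(* X, ..., T are the alternations of the six kinds of terms of phi'; Y and V vanish,
   Z is a multiple of X and T is minus the sum of the three values of W. *)
have X s : alt5 (fun w x y z t => coord 8 w * base_part s x y z t) x y z t u =
    alt5 (fun w x y z t => coord 8 w * base_part 0 x y z t) x y z t u.
  by rewrite /alt5 !(base_part_eq s).
have Y s : alt5 (fun w x y z t => coord 8 w * line_part p s x y z t) x y z t u = 0.
  exact: alt5_wedge_self.
have Z s : alt5 (fun w => line_part' w s) x y z t u =
    - alt5 (fun w x y z t => coord 8 w * base_part s x y z t) x y z t u.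
  exact: alt5_line.
have V s : alt5 (fun w => fibre_part' p w s) x y z t u = 0.
  transitivity (alt5 (fun w x y z t => eta p (s + 2) w * wedge22 (omega s) (omega (s + 1)) x y z t)
      x y z t u
    - alt5 (fun w x y z t => eta p (s + 1) w * wedge22 (omega s) (omega (s + 2)) x y z t)
      x y z t u); first exact: alt5_fibre.
  by rewrite /alt5 !omega_wedge_omega //; ring.
pose W s := alt5 (fun w x y z t => coord 8 w * fibre_part p s x y z t) x y z t u.
have T s : alt5 (fun w => vertical_part' p w s) x y z t u = - (W 0 + W 1 + W 2%R).
  transitivity (- alt5 (fun w x y z t => coord 8 w * (fibre_part p s x y z t
      + fibre_part p (s + 1) x y z t + fibre_part p (s + 2) x y z t)) x y z t u).
    move: s; apply: ord3_ind; rewrite /vertical_part' /fibre_part !ord3D; exact: alt5_vertical.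
  by rewrite /W /alt5; move: s; apply: ord3_ind; rewrite !ord3D; ring.
transitivity (\sum_s (
      alpha' p * alt5 (fun w x y z t => coord 8 w * base_part s x y z t) x y z t u
    + (alpha' p / (3 * height p s) - alpha p / (3 * height p s ^+ 2))
        * alt5 (fun w x y z t => coord 8 w * line_part p s x y z t) x y z t u
    + alpha p / (3 * height p s) * (2 * alt5 (fun w => line_part' w s) x y z t u)
    + 12 * W s
    + 12 * height p s * (2 * alt5 (fun w => fibre_part' p w s) x y z t u)
    + 4 * alt5 (fun w => vertical_part' p w s) x y z t u)).
  by rewrite /alt5 /phi' !big_ord3 /W /alt5; ring.
(* The coefficient of X is 3 alpha' - (2/3) alpha (1/v_1 + 1/v_2 + 1/v_3), that of
   each W is 12 - 3 * 4. *)
rewrite big_ord3 !Y !Z !V !T !X /alpha' big_ord3.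
by field; rewrite !gt_eqF // height_gt0.
Qed.

Lemma closed_heis_Phi : closed_form U heis_Phi.
Proof.
move=> p v Up.
by rewrite (alt5_ext_d v (fun w x y z t => is_derive_phi w x y z t Up)) alt5_phi'.
Qed.

(** * Failure of parallelism *)

Definition basis (k : nat) : E := delta_mx (inord k.-1) 0.

Lemma coord_basis k l : (0 < k <= 8)%N -> (0 < l <= 8)%N ->
  coord k (basis l) = (k == l)%:R :> R.
Proof.
case: k => // k; case: l => // l /= k8 l8.
by rewrite /coord mxE eqxx andbT -val_eqE /= !inordK.
Qed.

Lemma inner_heisE p (x y : E) : U p ->
  inner (g p) x y =
    scale 0 p ^+ 2 * (coord 1 x * coord 1 y + coord 2 x * coord 2 y
                      + coord 3 x * coord 3 y + coord 4 x * coord 4 y)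
    + \sum_s fibre_scale s p ^+ 2 * (eta p s x * eta p s y)
    + scale (inord 7) p ^+ 2 * (coord 8 x * coord 8 y).
Proof.
move=> Up; rewrite inner_heis // mxE.
under eq_bigr do rewrite mxE.
by rewrite big_ord8 big_ord3 !coframe_coords; ring.
Qed.

(** The factors d depend on u alone; they enter the components of nabla Phi below
    through one common unknown. *)
Lemma is_derive_scale p i : U p -> exists d, forall w, is_derive p w (scale i) (d * coord 8 w).
Proof.
move=> Up; have dM c r1 r2 r3 : exists d, forall w,
    is_derive p w (fun q => c * monomial r1 r2 r3 q) (d * coord 8 w).
  eexists => w; have h := is_derive_fun_mul (is_derive_fun_cst p w c)
    (is_derive_monomial w r1 r2 r3 Up).
  by apply: (is_derive_eq h); rewrite mul0r add0r !mulrA.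
by case: i => [[|[|[|[|[|[|[|[|i]]]]]]]] //= lti]; exact: dM.
Qed.

Definition base_dot (x y : E) : R :=
  coord 1 x * coord 1 y + coord 2 x * coord 2 y
  + coord 3 x * coord 3 y + coord 4 x * coord 4 y.

Lemma derive_inner_heis p : U p -> exists dA dD (dB : 'I_3 -> R), forall w x y,
  'D_w (fun q => inner (g q) x y) p =
    (dA * base_dot x y + \sum_s dB s * (eta p s x * eta p s y)
     + dD * (coord 8 x * coord 8 y)) * coord 8 w
    + \sum_s 2 * fibre_scale s p ^+ 2 *
      (twist_form s w x * eta p s y + eta p s x * twist_form s w y).
Proof.
move=> Up; have [d dE] := choice (fun i => is_derive_scale i Up).
exists (2 * scale 0 p * d 0), (2 * scale (inord 7) p * d (inord 7)),
  (fun s => 2 * fibre_scale s p * d (inord (s + 4))) => w x y.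
pose G q := scale 0 q * scale 0 q * base_dot x y
  + (fibre_scale 0 q * fibre_scale 0 q * (eta q 0 x * eta q 0 y)
     + fibre_scale 1 q * fibre_scale 1 q * (eta q 1 x * eta q 1 y)
     + fibre_scale 2%R q * fibre_scale 2%R q * (eta q 2%R x * eta q 2%R y))
  + scale (inord 7) q * scale (inord 7) q * (coord 8 x * coord 8 y).
rewrite (near_eq_derive (g := G)); last first.
  apply: (eq_near_open open_heis_domain) Up => q Uq.
  by rewrite inner_heisE // big_ord3 /G /base_dot !expr2.
have sq i c := is_derive_fun_mul (is_derive_fun_mul (dE i w) (dE i w)) (is_derive_fun_cst p w c).
have dV s : is_derive p w (fibre_scale s) (d (inord (s + 4)) * coord 8 w) by exact: dE.
have term s := is_derive_fun_mul (is_derive_fun_mul (dV s) (dV s))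
  (is_derive_fun_mul (is_derive_eta p w s x) (is_derive_eta p w s y)).
have := is_derive_fun_add (is_derive_fun_add (sq 0 (base_dot x y))
  (is_derive_fun_add (is_derive_fun_add (term 0) (term 1)) (term 2%R)))
  (sq (inord 7) (coord 8 x * coord 8 y)).
move=> [_ ->]; rewrite !big_ord3; ring.
Qed.

Lemma levi_civita_heis p i j (Z : E) : U p ->
  (forall m, let D w x y := 'D_w (fun q => inner (g q) x y) p in
     let bi := delta_mx i 0 in let bj := delta_mx j 0 in let bm := delta_mx m 0 in
     inner (g p) Z bm = 2^-1 * (D bi bj bm + D bj bi bm - D bm bi bj)) ->
  levi_civita g p (delta_mx i 0) (delta_mx j 0) = Z.
Proof.
move=> Up gZ; have [_ /(_ p Up) [gT _]] := riemannian_heis_metric.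
have gU : g p \in unitmx.
  rewrite heis_metricE // unitmx_mul unitmx_tr.
  by case/mulmx1_unit: (frameK Up) => _ ->.
apply: levi_civita_koszul => // m; rewrite gZ /partial.
have ent k l : (fun q => inner (g q) (delta_mx k 0) (delta_mx l 0)) = (fun q => g q k l).
  by apply/funext => q; rewrite inner_delta2.
by rewrite !ent.
Qed.

Section BasePoint.
Variable u : R.
Let p0 : E := u *: basis 8.
Hypothesis Up0 : U p0.

Lemma coord_p0 k : (0 < k <= 8)%N -> coord k p0 = u * (k == 8)%:R.
Proof. by move=> k8; rewrite -coord_basis // linearZ. Qed.

Lemma eta_p0 s (x : E) : eta p0 s x = coord (s + 5) x.
Proof.
rewrite /eta; move: s; apply: ord3_ind; rewrite /twist_form /= !coord_p0 //=; ring.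
Qed.

Lemma coordZ c k (x : E) : coord k (c *: x) = c * coord k x.
Proof. exact: linearZ. Qed.

Lemma scale_p0_neq0 i : scale i p0 != 0.
Proof. by rewrite gt_eqF // scale_gt0. Qed.

(** At points with x = 0 the coordinate frame is orthogonal and the derivatives of
    the metric along d/dx_1 are those of the twist, which leaves one nonzero
    component in each of the next three covariant derivatives. *)
Lemma levi_civita_11 : exists k, levi_civita g p0 (basis 1) (basis 1) = (- k) *: basis 8.
Proof.
have [dA [dD [dB DE]]] := derive_inner_heis Up0.
exists (2^-1 * dA / scale (inord 7) p0 ^+ 2); apply: levi_civita_heis => // m /=.
rewrite -![delta_mx (inord _) 0]/(basis 1) inner_heisE // !DE.
rewrite !big_ord3 !eta_p0 !ord3_val /base_dot /twist_form /= !coordZ !coord_basis //=.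
by field; exact: scale_p0_neq0.
Qed.

Lemma levi_civita_base (s : 'I_3) :
  levi_civita g p0 (basis 1) (basis (s + 2)) = basis (s + 5).
Proof.
have [dA [dD [dB DE]]] := derive_inner_heis Up0.
apply: (@levi_civita_heis p0 (inord 0) (inord (s + 2).-1)) => // m /=.
rewrite -![delta_mx (inord 0) 0]/(basis 1) -![delta_mx (inord (s + 2).-1) 0]/(basis (s + 2)).
rewrite inner_heisE // !DE !big_ord3 !eta_p0 !ord3_val /base_dot /twist_form /=.
by move: s; apply: ord3_ind; rewrite !ord3_val !coord_basis //=; field.
Qed.

Lemma levi_civita_fibre (s : 'I_3) :
  levi_civita g p0 (basis 1) (basis (s + 5)) =
  (fibre_scale s p0 ^+ 2 / scale 0 p0 ^+ 2) *: basis (s + 2).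
Proof.
have [dA [dD [dB DE]]] := derive_inner_heis Up0.
apply: (@levi_civita_heis p0 (inord 0) (inord (s + 5).-1)) => // m /=.
rewrite -![delta_mx (inord 0) 0]/(basis 1) -![delta_mx (inord (s + 5).-1) 0]/(basis (s + 5)).
rewrite inner_heisE // !DE !big_ord3 !eta_p0 !ord3_val /base_dot /twist_form /= !coordZ.
by move: s; apply: ord3_ind; rewrite !ord3_val !coord_basis //=; field; exact: scale_p0_neq0.
Qed.

Lemma phi_scale_l p c (x y z t : E) : phi p (c *: x) y z t = c * phi p x y z t.
Proof.
have bZ s (v : E) : twist_form s (c *: x) v = c * twist_form s x v.
  by move: s; apply: ord3_ind; rewrite /twist_form /= !coordZ; ring.
have bZr s (v : E) : twist_form s v (c *: x) = c * twist_form s v x.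
  by move: s; apply: ord3_ind; rewrite /twist_form /= !coordZ; ring.
have wZ (F G : E -> E -> R) : (forall v, F (c *: x) v = c * F x v) ->
    (forall v, G (c *: x) v = c * G x v) ->
    wedge22 F G (c *: x) y z t = c * wedge22 F G x y z t.
  by move=> FZ GZ; rewrite /wedge22 !FZ !GZ; ring.
have oZ s v : omega s (c *: x) v = c * omega s x v by rewrite /omega /skew bZ bZr mulrBr.
have eZ s : eta p s (c *: x) = c * eta p s x by rewrite /eta coordZ bZr; ring.
rewrite /phi mulr_sumr; apply: eq_bigr => s _.
rewrite /base_part /line_part /fibre_part /vertical_part !wZ //;
  try by move=> v; rewrite /wedge11 ?eZ ?coordZ; ring.
ring.
Qed.

Lemma phi_swap_ends p (x y z t : E) : phi p x y z t = - phi p t y z x.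
Proof.
have oN s (v w : E) : omega s v w = - omega s w v by rewrite /omega /skew opprB.
have wN (f h : E -> R) v w : wedge11 f h v w = - wedge11 f h w v
  by rewrite /wedge11 opprB mulrC [f w * _]mulrC.
have wedgeN (F G : E -> E -> R) : (forall v w, F v w = - F w v) ->
    (forall v w, G v w = - G w v) -> wedge22 F G x y z t = - wedge22 F G t y z x.
  move=> FN GN.
  rewrite /wedge22 [F z t]FN [F y t]FN [F x t]FN [F y x]FN [F z x]FN
    [G z t]GN [G y t]GN [G x t]GN [G y x]GN [G z x]GN; ring.
rewrite /phi -sumrN; apply: eq_bigr => s _.
rewrite /base_part /line_part /fibre_part /vertical_part !wedgeN //; ring.
Qed.

Lemma phi_scale_r p c (x y z t : E) : phi p x y z (c *: t) = c * phi p x y z t.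
Proof. by rewrite phi_swap_ends phi_scale_l -mulrN -phi_swap_ends. Qed.

Definition ebasis (s : 'I_3) : E := basis (s + 2).
Definition hbasis (s : 'I_3) : E := basis (s + 5).

(* At p0 the forms from which phi is built take integer values on the coordinate
   vectors; the tables reduce the evaluation of phi to closed computations in int. *)

Definition du_table (k : nat) : int := (k == 8)%N%:Z.
Definition eta_table (s : 'I_3) (k : nat) : int := (k == (s + 5)%N)%:Z.
Definition twist_table (s : 'I_3) (k l : nat) : int :=
  nth 0 [:: (k == 1)%N%:Z * (l == 2)%N%:Z + (k == 3)%N%:Z * (l == 4)%N%:Z;
            (k == 1)%N%:Z * (l == 3)%N%:Z + (k == 4)%N%:Z * (l == 2)%N%:Z;
            (k == 1)%N%:Z * (l == 4)%N%:Z + (k == 2)%N%:Z * (l == 3)%N%:Z] s.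

Let on_basis1 (f : E -> R) (ft : nat -> int) :=
  forall k, (0 < k <= 8)%N -> f (basis k) = (ft k)%:~R.
Let on_basis2 (F : E -> E -> R) (Ft : nat -> nat -> int) :=
  forall k l, (0 < k <= 8)%N -> (0 < l <= 8)%N -> F (basis k) (basis l) = (Ft k l)%:~R.

Lemma du_on_basis : on_basis1 (coord 8) du_table.
Proof. by move=> k k8; rewrite coord_basis // eq_sym. Qed.

Lemma eta_on_basis s : on_basis1 (eta p0 s) (eta_table s).
Proof.
have s5 : (0 < s + 5 <= 8)%N by rewrite addn_gt0 orbT (leq_add2r 5 s 3) ltnW.
by move=> k k8; rewrite eta_p0 coord_basis // /eta_table eq_sym -pmulrn.
Qed.

Lemma twist_on_basis s : on_basis2 (twist_form s) (twist_table s).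
Proof.
move=> k l k8 l8; rewrite /twist_form /twist_table.
by move: s; apply: ord3_ind; rewrite /= !coord_basis // rmorphD !rmorphM /= !(eq_sym _ k)
  !(eq_sym _ l).
Qed.

Lemma omega_on_basis s : on_basis2 (omega s) (skew (twist_table s)).
Proof. by move=> k l k8 l8; rewrite /omega /skew !twist_on_basis // rmorphB. Qed.

Lemma wedge11_on_basis f g ft gt : on_basis1 f ft -> on_basis1 g gt ->
  on_basis2 (wedge11 f g) (wedge11 ft gt).
Proof. by move=> fE gE k l k8 l8; rewrite /wedge11 !fE // !gE // rmorphB !rmorphM. Qed.

Lemma wedge22_on_basis F G Ft Gt k l m n : on_basis2 F Ft -> on_basis2 G Gt ->
  [&& 0 < k <= 8, 0 < l <= 8, 0 < m <= 8 & 0 < n <= 8]%N ->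
  wedge22 F G (basis k) (basis l) (basis m) (basis n) = (wedge22 Ft Gt k l m n)%:~R.
Proof.
move=> FE GE /and4P[k8 l8 m8 n8].
by rewrite /wedge22 !FE // !GE // !(rmorphD, rmorphN, rmorphM).
Qed.

Lemma phi_on_basis k l m n :
  [&& 0 < k <= 8, 0 < l <= 8, 0 < m <= 8 & 0 < n <= 8]%N ->
  phi p0 (basis k) (basis l) (basis m) (basis n) =
  \sum_s (alpha p0 * (wedge22 (skew (twist_table s)) (skew (twist_table s)) k l m n)%:~R
    + alpha p0 / (3 * height p0 s) *
      (wedge22 (skew (twist_table s)) (wedge11 du_table (eta_table s)) k l m n)%:~R
    + 12 * height p0 s * (wedge22 (skew (twist_table s))
      (wedge11 (eta_table (s + 1)) (eta_table (s + 2))) k l m n)%:~R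
    + 2 * (wedge22 (wedge11 du_table (eta_table s))
      (wedge11 (eta_table (s + 1)) (eta_table (s + 2))) k l m n)%:~R).
Proof.
move=> klmn; apply: eq_bigr => s _.
have oE := omega_on_basis s; have dE := wedge11_on_basis du_on_basis (eta_on_basis s).
have eE := wedge11_on_basis (eta_on_basis (s + 1)) (eta_on_basis (s + 2)).
rewrite /base_part /line_part /fibre_part /vertical_part.
by rewrite !(wedge22_on_basis oE oE, wedge22_on_basis oE dE, wedge22_on_basis oE eE,
  wedge22_on_basis dE eE).
Qed.

Lemma phi'_on_basis k l m n :
  [&& 0 < k <= 8, 0 < l <= 8, 0 < m <= 8 & 0 < n <= 8]%N ->
  phi' p0 (basis 1) (basis k) (basis l) (basis m) (basis n) =
  \sum_s (alpha p0 / (3 * height p0 s) * (2 * (wedge22 (skew (twist_table s))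
      (wedge11 du_table (twist_table s 1)) k l m n)%:~R)
    + 12 * height p0 s * (2 * ((wedge22 (skew (twist_table s))
        (wedge11 (twist_table (s + 1) 1) (eta_table (s + 2))) k l m n)%:~R
      + (wedge22 (skew (twist_table s))
        (wedge11 (eta_table (s + 1)) (twist_table (s + 2) 1)) k l m n)%:~R))
    + 4 * ((wedge22 (wedge11 du_table (twist_table s 1))
        (wedge11 (eta_table (s + 1)) (eta_table (s + 2))) k l m n)%:~R
      + (wedge22 (wedge11 du_table (eta_table s))
        (wedge11 (twist_table (s + 1) 1) (eta_table (s + 2))) k l m n)%:~R
      + (wedge22 (wedge11 du_table (eta_table s))
        (wedge11 (eta_table (s + 1)) (twist_table (s + 2) 1)) k l m n)%:~R)).
Proof.
move=> klmn; apply: eq_bigr => s _.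
have bE i : on_basis1 (twist_form i (basis 1)) (twist_table i 1).
  by move=> j j8; exact: twist_on_basis.
have oE := omega_on_basis s.
have dbE := wedge11_on_basis du_on_basis (bE s).
have deE := wedge11_on_basis du_on_basis (eta_on_basis s).
have eeE := wedge11_on_basis (eta_on_basis (s + 1)) (eta_on_basis (s + 2)).
have beE := wedge11_on_basis (bE (s + 1)) (eta_on_basis (s + 2)).
have ebE := wedge11_on_basis (eta_on_basis (s + 1)) (bE (s + 2)).
rewrite du_on_basis // (_ : du_table 1 = 0) //.
rewrite /line_part' /fibre_part' /vertical_part'.
rewrite !(wedge22_on_basis oE dbE, wedge22_on_basis oE beE, wedge22_on_basis oE ebE,
  wedge22_on_basis dbE eeE, wedge22_on_basis deE beE, wedge22_on_basis deE ebE) //.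
by ring.
Qed.

(* Both sides are closed integers once the indices are. *)
Local Ltac compute_wedges := repeat match goal with
  |- context [@wedge22 ?A ?T ?F ?G ?k ?l ?m ?n] =>
    let z := eval vm_compute in (@wedge22 A T F G k l m n) in
    rewrite (_ : @wedge22 A T F G k l m n = z); last by vm_compute
  end.

(** The values of the form on the test vectors with one entry replaced by its
    covariant derivative, up to a factor. *)
Lemma phi_values (s : 'I_3) :
  [/\ phi p0 (basis 8) (ebasis (s + 1)) (ebasis (s + 2)) (hbasis s) =
        alpha p0 / (3 * height p0 s),
      phi p0 (basis 1) (hbasis (s + 1)) (ebasis (s + 2)) (hbasis s) = 12 * height p0 (s + 2),
      phi p0 (basis 1) (ebasis (s + 1)) (hbasis (s + 2)) (hbasis s) = 12 * height p0 (s + 1) &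
      phi p0 (basis 1) (ebasis (s + 1)) (ebasis (s + 2)) (ebasis s) = 6 * alpha p0].
Proof.
move: s; rewrite /ebasis /hbasis; apply: ord3_ind; rewrite !ord3D !ord3_val; split;
  rewrite phi_on_basis // big_ord3 !ord3D; compute_wedges; ring.
Qed.

Lemma phi'_value (s : 'I_3) :
  phi' p0 (basis 1) (basis 1) (ebasis (s + 1)) (ebasis (s + 2)) (hbasis s) =
  24 * height p0 (s + 1) + 24 * height p0 (s + 2).
Proof.
move: s; rewrite /ebasis /hbasis; apply: ord3_ind; rewrite !ord3D !ord3_val;
  rewrite phi'_on_basis // big_ord3 !ord3D; compute_wedges; ring.
Qed.

(** Three horizontal vectors and the vertical vector that matches the missing one:
    the components of nabla Phi which see the differences of the B_s. *)
Definition test_vectors (s : 'I_3) (i : 'I_4) : E :=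
  nth 0 [:: basis 1; ebasis (s + 1); ebasis (s + 2); hbasis s] i.

Lemma cov_deriv_component : exists k, forall s,
  cov_deriv g heis_Phi p0 (basis 1) (test_vectors s) =
  12 * height p0 (s + 1) + 12 * height p0 (s + 2) + k * (alpha p0 / (3 * height p0 s))
  - fibre_scale s p0 ^+ 2 / scale 0 p0 ^+ 2 * (6 * alpha p0).
Proof.
have [k k11] := levi_civita_11; exists k => s.
have [v8 vt vr ve] := phi_values s.
rewrite /cov_deriv /heis_Phi /test_vectors.
rewrite !big_ord_recl big_ord0 /= !addr0.
have [_ ->] := is_derive_phi (basis 1) (basis 1) (ebasis (s + 1)) (ebasis (s + 2)) (hbasis s) Up0.
rewrite phi'_value k11 !levi_civita_base // levi_civita_fibre //.
rewrite phi_scale_l v8 vt vr phi_scale_r ve; ring.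
Qed.

(** The three components yield 4 B_s = B_1 + B_2 + B_3 + k D, so the B_s coincide,
    and u + a_s is a fixed multiple of A^2 B_t B_r. *)
Lemma parallel_height_eq : parallel_form U g heis_Phi ->
  forall s, height p0 s = height p0 0.
Proof.
move=> par; have [k kE] := cov_deriv_component.
pose A := scale 0 p0; pose D := scale (inord 7) p0; pose V s := fibre_scale s p0.
have A0 : A != 0 by exact: scale_p0_neq0.
have V0 s : V s != 0 by exact: scale_p0_neq0.
have VS s : 4 * V s = V 0 + V 1 + V 2%R + k * D.
  have := kE s; rewrite par //.
  have [al cS cBB _] := coefficients s Up0.
  have [_ _ cBB1 _] := coefficients (s + 1) Up0.
  have [_ _ cBB2 _] := coefficients (s + 2) Up0.
  rewrite -cS -cBB1 -cBB2 -al -/A -/D -/(V s).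
  rewrite -![s + _ + _]addrA !ord3D addr0.
  have -> : V 0 + V 1 + V 2%R = V s + V (s + 1) + V (s + 2).
    by move: s {al cS cBB cBB1 cBB2}; apply: ord3_ind; rewrite !ord3D; ring.
  rewrite -/(V s) -/(V (s + 1)) -/(V (s + 2)) => E0.
  have : 2 * A ^+ 2 * V s * (4 * V s - (V s + V (s + 1) + V (s + 2) + k * D)) = 0.
    by rewrite -[RHS]oppr0 [in RHS]E0; field.
  have c0 : 2 * A ^+ 2 * V s != 0 by rewrite mulf_neq0 ?V0 // mulf_neq0 ?pnatr_eq0 // expf_neq0.
  by move/eqP; rewrite mulf_eq0 (negPf c0) /= subr_eq0 => /eqP.
have Veq s : V s = V 0.
  by apply: (@mulfI _ (4%:R : R)); rewrite ?pnatr_eq0 //= !VS.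
move=> s; have [_ _ cs _] := coefficients s Up0; have [_ _ c0 _] := coefficients 0 Up0.
apply: (@mulfI _ (12%:R : R)); rewrite ?pnatr_eq0 //= -cs -c0.
by rewrite -![fibre_scale _ p0]/(V _) !Veq.
Qed.
End BasePoint.
End Heisenberg.

Unset Implicit Arguments.

Theorem proposition5p3 (R : realType) (C a1 a2 a3 : R) (hC : 0 < C)
    (ha : ~ (a1 = a2 /\ a2 = a3)) :
  exists (Q : 'cV[R]_8 -> {vspace 'M[R]_8}) (Phi : @diff_form R 7 4),
    [/\ almost_quaternion_hermitian (heis_domain a1 a2 a3) (heis_metric C a1 a2 a3) Q,
        is_fundamental_form (heis_domain a1 a2 a3) (heis_metric C a1 a2 a3) Q Phi,
        closed_form (heis_domain a1 a2 a3) Phi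
      & ~ quaternionic_kahler (heis_domain a1 a2 a3) (heis_metric C a1 a2 a3) Q].
Proof.
exists (heis_Q C a1 a2 a3), (heis_Phi C a1 a2 a3); split.
- split; first exact: riemannian_heis_metric.
  move=> p Up; exists (heis_domain a1 a2 a3); split=> //; first exact: open_heis_domain.
  do 3!eexists; exact: heis_quaternionic_frame.
- exact: heis_Phi_fundamental.
- exact: closed_heis_Phi.
- move=> /(_ _ (heis_Phi_fundamental hC)) par; apply: ha.
  (* A height u at which the three functions u + a_s are positive. *)
  pose u := 1 + `|a1| + `|a2| + `|a3|.
  have n1 := ler_norm (- a1); have n2 := ler_norm (- a2); have n3 := ler_norm (- a3).
  have m1 := normr_ge0 a1; have m2 := normr_ge0 a2; have m3 := normr_ge0 a3.
  rewrite !normrN in n1 n2 n3.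
  have Up0 : heis_domain a1 a2 a3 (u *: basis R 8).
    by rewrite /heis_domain /= coordZ coord_basis //= mulr1 /u; split; lra.
  have v := parallel_height_eq hC Up0 par; have := v 1; have := v 2%R.
  by rewrite /height /= => /addrI a31 /addrI a21; rewrite a31 a21.
Qed.
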